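(* Let $n$ be a positive integer and $\xi$ a transcendental real number. Then \[ \widehat{w}_{n}(\xi)\le \frac{2\left(w_n^{\ast}(\xi)+n\right)-1}{3}, \] and, if $w_n(\xi)\le 2n-1$, then \[ \widehat{w}_{n}^{\ast}(\xi)\geq \frac{2w_{n}^{\ast}(\xi)^{2}-w_{n}^{\ast}(\xi)-2n+1}{2w_{n}^{\ast}(\xi)^{2}-nw_{n}^{\ast}(\xi)-n}. \]
   Context: The height $H(P)$ of an integer polynomial $P$ is the maximum of the absolute values of its coefficients; the height $H(\alpha)$ of an algebraic number $\alpha$ is the height of its minimal polynomial over $\mathbb{Z}$. For a real $\xi$ and integer $k\ge1$: $w_{k}(\xi)$ is the supremum of the real $w$ such that $0<|P(\xi)|\le H(P)^{-w}$ has infinitely many solutions $P\in\mathbb{Z}[X]$ of degree at most $k$; $\widehat{w}_{k}(\xi)$ is the supremum of the real $w$ such that for all sufficiently large $H$ the system $0<|P(\xi)|\le H^{-w}$, $H(P)\le H$, has a solution $P\in\mathbb{Z}[X]$ of degree at most $k$; $w_{k}^{\ast}(\xi)$ is the supremum of the real $w$ such that $0<|\xi-\alpha|\le H(\alpha)^{-w-1}$ has infinitely many solutions in algebraic numbers $\alpha$ of degree at most $k$; $\widehat{w}_{k}^{\ast}(\xi)$ is the supremum of the real $w$ such that for all sufficiently large $H$ there is an algebraic number $\alpha$ of degree at most $k$ with $0<|\xi-\alpha|\le H(\alpha)^{-1}H^{-w}$ and $H(\alpha)\le H$. *)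

(* Defs.v *)
From HB Require Import structures.
From mathcomp Require Import all_boot all_order all_algebra.
From mathcomp Require Import complex.
From mathcomp Require Import all_classical all_reals all_analysis.
Set Implicit Arguments.
Unset Strict Implicit.
Unset Printing Implicit Defensive.
Import Order.TTheory GRing.Theory Num.Theory.
Import numFieldNormedType.Exports.
Local Open Scope classical_set_scope.
Local Open Scope ring_scope.

Definition height (P : {poly int}) : nat :=
  (\max_(i < size P) absz (P`_i)%R)%N.

(* [zcontents P] carries the sign of the leading coefficient, so
   [zcontents P = 1] means that the coefficients of [P] are globally coprime
   and that its leading coefficient is positive. *)
Definition is_minpolyZ (F : fieldType) (P : {poly int}) (a : F) : Prop :=
  [/\ zcontents P = 1,
      irreducible_poly (map_poly (intr : int -> rat) P)
    & root (map_poly intr P) a].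

Definition transcendental (R : realType) (xi : R) : Prop :=
  ~ algebraicOver (ratr : rat -> R) xi.

Section Exponents.
Variables (R : realType) (k : nat) (xi : R).

Let eval (P : {poly int}) : R := (map_poly intr P).[xi].

(* Algebraic numbers are complex; [normc] is the modulus as an element of R. *)
Let dist (a : R[i]) : R := ComplexField.Normc.normc (xi%:C%C - a).

(* The exponents may be infinite, hence suprema in [\bar R]. *)
Definition w_exp : \bar R :=
  ereal_sup (EFin @` [set w : R |
    infinite_set [set P : {poly int} |
      (size P <= k.+1)%N /\
      0 < `|eval P| <= (height P)%:R `^ (- w)]]).

Definition w_hat : \bar R :=
  ereal_sup (EFin @` [set w : R |
    \forall H \near +oo, exists P : {poly int},
      [/\ (size P <= k.+1)%N,
          0 < `|eval P| <= H `^ (- w)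
        & (height P)%:R <= H]]).

Definition w_star : \bar R :=
  ereal_sup (EFin @` [set w : R |
    infinite_set [set a : R[i] | exists P : {poly int},
      [/\ is_minpolyZ P a,
          (size P <= k.+1)%N
        & 0 < dist a <= (height P)%:R `^ (- w - 1)]]]).

Definition w_hat_star : \bar R :=
  ereal_sup (EFin @` [set w : R |
    \forall H \near +oo, exists (a : R[i]) (P : {poly int}),
      [/\ is_minpolyZ P a,
          (size P <= k.+1)%N,
          0 < dist a <= (height P)%:R^-1 * H `^ (- w)
        & (height P)%:R <= H]]).

End Exponents.

(* Main.v *)
(** Write [w], [v], [s] for the exponents [w_n], [w_hat_n], [w_n^*] of [xi].
    The heart of the proof is the inequality [w + 2 v <= 2 s + 2 n - 1].  Take
    an irreducible [P] of large height [H] with [|P(xi)|] about [H^-w], and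
    [Q] of height slightly smaller than [H] with [|Q(xi)| <= H^-v]; then [P]
    does not divide [Q] and [1 <= |Res(P, Q)|].  Since the root of [P] closest
    to [xi] is at distance at most [n |P(xi) / P'(xi)|], the definition of [s]
    gives [|P'(xi)| <= |P(xi)| H^(s+1)], and similarly for [Q].  Expanding the
    Sylvester determinant of [P(X + xi)] and [Q(X + xi)] along the three
    columns of lowest degree, every term is at most [H^(2n-2-2v)], which is
    small because [v >= n], or [H^(2n-1+2s-w-2v)].

    As [w >= v], this is the first claim.  For the second one, the pigeonhole
    principle gives [P] with [|P(xi)| <= H^-t], [|P'(xi)|] at most about
    [H^(t-n+1)] and the coefficients of degree at least two at most [H]
    (Davenport and Schmidt).  If [t > v], respectively [t > w], the height of
    [P] must come from [P'(xi)] for arbitrarily large, respectively all large,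
    [H], so [P] has a root very close to [xi].  This gives
    [s >= v / (v - n + 1)] and [w_hat_n^* >= w / (w - n + 1)], and the claim
    follows by elimination of [v] and [w]. *)
Require Import Defs.
From mathcomp Require Import all_boot all_order all_algebra.
From mathcomp Require Import perm complex.
From mathcomp Require Import all_classical all_reals all_analysis.
From mathcomp Require Import ring lra zify.

Set Implicit Arguments.
Unset Strict Implicit.
Unset Printing Implicit Defensive.
Import Order.TTheory GRing.Theory Num.Theory.
Import numFieldNormedType.Exports.
Local Open Scope ring_scope.

(** * Heights and minimal polynomials *)

Lemma coef_le_height (P : {poly int}) i : (absz (P`_i)%R <= height P)%N.
Proof.
have [lt_i | le_i] := ltnP i (size P); last by rewrite nth_default.
exact: (leq_bigmax (Ordinal lt_i)).
Qed.

Lemma norm_coef_le_height (R : numDomainType) (P : {poly int}) i :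
  `|(P`_i)%:~R : R| <= (height P)%:R.
Proof. by rewrite -intr_norm -abszE -pmulrn ler_nat coef_le_height. Qed.

Lemma height_ler (R : realDomainType) (P : {poly int}) (B : R) :
  0 <= B -> (forall i, `|(P`_i)%:~R| <= B) -> (height P)%:R <= B.
Proof.
move=> B0 HB; rewrite /height.
elim/big_ind: _ => // [x y hx hy|i _]; first by rewrite /maxn; case: ifP.
by rewrite pmulrn abszE intr_norm.
Qed.

Lemma height_gt0 (P : {poly int}) : P != 0 -> (0 < height P)%N.
Proof.
move=> P0; apply: leq_trans (coef_le_height P (size P).-1).
by rewrite -lead_coefE absz_gt0 lead_coef_eq0.
Qed.

Lemma height_ge1 (R : numDomainType) (P : {poly int}) :
  P != 0 -> 1 <= (height P)%:R :> R.
Proof. by move=> P0; rewrite ler1n height_gt0. Qed.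


(* Newton interpolation: [p = p(a) + (X - a) r], and [|j - a| >= 1] for
   distinct integers. *)
Lemma coef_interpolation (R : realFieldType) (N m : nat) :
  exists2 C : R, 0 < C & forall (p : {poly R}) (s : seq nat) (M : R),
    0 <= M -> (size p <= m)%N ->
    uniq s -> all (fun j => j <= N)%N s -> size s = m ->
    (forall j, j \in s -> `|p.[j%:R]| <= M) -> forall i, `|p`_i| <= C * M.
Proof.
elim: m => [|m [C C0 IH]].
  exists 1 => // p s M M0; rewrite leqn0 size_poly_eq0 => /eqP -> _ _ _ _ i.
  by rewrite coef0 normr0 mul1r.
have N0 : 0 <= N%:R :> R by [].
(* The quotient [r] is at most [2 * M] on the remaining points, so its coefficients are at most
   [C * (2 * M)]; multiplying back by [X - a] with [a <= N] costs the factor [1 + N]. *)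
exists (1 + (1 + N%:R) * (C * 2)); first by nra.
move=> p [//|a s] M M0 sp /= /andP[a_s us] /andP[aN sN] [ss] pM i.
have pa : `|p.[a%:R]| <= M by apply: pM; rewrite mem_head.
have : root (p - (p.[a%:R])%:P) a%:R by rewrite rootE !hornerE subrr.
move=> /factor_theorem[r Er].
have sr : (size r <= m)%N.
  have [->|r0] := eqVneq r 0; first by rewrite size_poly0.
  have : (size (r * ('X - (a%:R)%:P))%R <= m.+1)%N.
    rewrite -Er (leq_trans (size_polyD _ _)) // geq_max sp size_polyN.
    by rewrite (leq_trans (size_polyC_leq1 _)).
  by rewrite size_Mmonic ?monicXsubC // size_XsubC addn2.
have rM j : j \in s -> `|r.[j%:R]| <= 2 * M.
  move=> js; have pj : `|p.[j%:R]| <= M by apply: pM; rewrite inE js orbT.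
  have ja : 1 <= `|j%:R - a%:R| :> R.
    have : j != a by apply: contraNneq a_s => <-.
    rewrite neq_ltn => /orP[] h.
      by rewrite distrC -natrB ?(ltnW h)// normr_nat ler1n subn_gt0.
    by rewrite -natrB ?(ltnW h)// normr_nat ler1n subn_gt0.
  have := congr1 (fun q => `|q.[j%:R]|) Er; rewrite !hornerE normrM => E.
  have : `|p.[j%:R] - p.[a%:R]| <= M + M by rewrite (le_trans (ler_normB _ _))// lerD.
  by rewrite E; move: (normr_ge0 r.[j%:R]); nra.
have rC k : `|r`_k| <= C * (2 * M).
  by apply: (IH r s) => //; rewrite ?mulr_ge0.
have {Er} Ep : p = (p.[a%:R])%:P + r * 'X - (a%:R)%:P * r.
  by move/eqP: Er; rewrite subr_eq => /eqP {1}->; ring.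
rewrite Ep coefB coefD coefCM coefMX coefC.
apply: (@le_trans _ _ (M + C * (2 * M) + N%:R * (C * (2 * M)))); last by nra.
apply: (le_trans (ler_normB _ _)); apply: lerD.
  apply: (le_trans (ler_normD _ _)); apply: lerD.
    by case: ifP; rewrite ?normr0.
  by case: ifP; rewrite ?normr0 ?mulr_ge0 // ?(ltW C0).
by rewrite normrM ler_pM // normr_nat ler_nat.
Qed.

Lemma norm_horner_le (R : realFieldType) (p : {poly R}) (m : nat) (B x : R) :
  (size p <= m)%N -> (forall i, `|p`_i| <= B) ->
  `|p.[x]| <= B * \sum_(i < m) `|x| ^+ i.
Proof.
move=> sp pB; rewrite (horner_coef_wide _ sp) mulr_sumr.
apply: (le_trans (ler_norm_sum _ _ _)); apply: ler_sum => i _.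
by rewrite normrM normrX ler_wpM2r // exprn_ge0.
Qed.

(* Gelfond's inequality: for each factor all but [n] of the points
   [0, ..., 2n] give a value comparable to the height, so one point serves
   both factors. *)
Lemma height_mul (R : realFieldType) (n : nat) :
  exists2 C : R, 0 < C & forall P Q : {poly int},
    (size P <= n.+1)%N -> (size Q <= n.+1)%N -> P != 0 -> Q != 0 ->
    (height P)%:R * (height Q)%:R <= C * (height (P * Q))%:R.
Proof.
have [C C0 HC] := coef_interpolation R (2 * n) n.+1.
pose ev (P : {poly int}) (j : nat) : R := (map_poly intr P).[j%:R].
pose I := iota 0 (2 * n).+1.
pose bad P j := `|ev P j| * (2 * C) < (height P)%:R.
(* At [n + 1] bad points, interpolation would bound every coefficient of [P] by half its height. *)
have badP (P : {poly int}) : (size P <= n.+1)%N -> P != 0 -> (count (bad P) I <= n)%N.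
  move=> sP P0; rewrite leqNgt; apply/negP => lt_n.
  pose s := take n.+1 [seq j <- I | bad P j].
  have ss : size s = n.+1 by rewrite size_takel // size_filter.
  have sI j : j \in s -> bad P j && (j \in I).
    by move=> /mem_take; rewrite mem_filter.
  have h0 := height_ge1 R P0; set h : R := (height P)%:R in h0.
  suff : h <= h / 2 by lra.
  apply: height_ler => [|i]; first by lra.
  rewrite -[X in _ <= X](_ : C * (h / (2 * C)) = _); last by field; rewrite gt_eqF.
  rewrite -coef_map.
  apply: (HC _ s) => //; first by apply: divr_ge0; lra.
  - by rewrite size_map_poly_id0 // intr_eq0 lead_coef_eq0.
  - by rewrite take_uniq // filter_uniq // iota_uniq.
  - apply/allP => j /sI /andP[_]; rewrite mem_iota; lia.
  - move=> j /sI /andP[+ _]; rewrite /bad -/(ev P j) -/h => /ltW.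
    by rewrite -ler_pdivlMr //; lra.
pose B : R := \sum_(i < (2 * n).+1) (2 * n)%:R ^+ i.
have B0 : 0 <= B by apply: sumr_ge0 => i _; apply: exprn_ge0.
exists ((2 * C) ^+ 2 * (B + 1)).
  by apply: mulr_gt0; [apply: exprn_gt0; lra | lra].
move=> P Q sP sQ P0 Q0.
have [j jI /norP[gP gQ]] : exists2 j, j \in I & ~~ (bad P j || bad Q j).
  apply/hasP; rewrite -[has _ _]negbK -all_predC; apply/negP => /allP al.
  have : (count (predU (bad P) (bad Q)) I = size I)%N.
    by apply/eqP; rewrite -all_count; apply/allP => j /al /=; rewrite negbK.
  move=> EU; have := count_predUI (bad P) (bad Q) I; rewrite EU size_iota => E.
  have := leq_add (badP P sP P0) (badP Q sQ Q0); rewrite -E leqNgt => /negP[].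
  by rewrite addnn -mul2n ltn_addr.
move: gP gQ; rewrite /bad -!leNgt => gP gQ.
have sPQ : (size (map_poly (intr : int -> R) (P * Q)%R) <= (2 * n).+1)%N.
  rewrite size_map_poly_id0 ?intr_eq0 ?lead_coef_eq0 ?mulf_neq0 //.
  apply: (leq_trans (size_polyMleq _ _)); move: sP sQ.
  by move: (size P) (size Q) => u v; lia.
have cPQ i : `|(map_poly (intr : int -> R) (P * Q))`_i| <= (height (P * Q))%:R.
  by rewrite coef_map norm_coef_le_height.
have := norm_horner_le j%:R sPQ cPQ; rewrite rmorphM hornerM normrM.
rewrite -/(ev P j) -/(ev Q j) => PQB.
have jB : \sum_(i < (2 * n).+1) `|j%:R| ^+ i <= B + 1.
  apply: (@le_trans _ _ B); last by lra.
  apply: ler_sum => i _; rewrite normr_nat lerXn2r ?nnegrE // ler_nat.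
  by move: jI; rewrite mem_iota; lia.
apply: (@le_trans _ _ ((`|ev P j| * (2 * C)) * (`|ev Q j| * (2 * C)))).
  exact: ler_pM.
rewrite [X in X <= _](_ : _ = (2 * C) ^+ 2 * (`|ev P j| * `|ev Q j|)); last by ring.
rewrite -mulrA ler_wpM2l ?exprn_ge0 //; first by lra.
apply: (le_trans PQB); rewrite mulrC ler_wpM2r //.
Qed.

Lemma size_factors (S : idomainType) (A B : {poly S}) : A != 0 -> B != 0 ->
  (size A <= size (A * B)%R)%N /\ (size B <= size (A * B)%R)%N.
Proof.
move=> A0 B0; rewrite size_mul //.
have : (0 < size A)%N by rewrite size_poly_gt0.
have : (0 < size B)%N by rewrite size_poly_gt0.
by move: (size A) (size B) => u v; lia.
Qed.

(** Gauss's lemma: a divisor over the rationals is a scalar multiple of an integer polynomial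
    dividing [P] over the integers. *)
Lemma reducible_factor (P : {poly int}) :
  (1 < size P)%N -> ~ irreducible_poly (map_poly (intr : int -> rat) P) ->
  exists A B : {poly int},
    [/\ P = A * B, (size A < size P)%N & (size B < size P)%N].
Proof.
move=> sP nirr; apply: contrapT => nAB; apply: nirr.
split; first by rewrite size_map_inj_poly //; apply: intr_inj.
move=> q sq qP; apply/negPn/negP => nq.
have [A [a a0 Eq] [B EB]] := dvdpP_rat_int qP.
have sqA : size q = size A.
  by rewrite Eq size_scale // size_map_inj_poly //; apply: intr_inj.
have sQ : size (map_poly (intr : int -> rat) P) = size P.
  by rewrite size_map_inj_poly //; apply: intr_inj.
have P0 : P != 0 by rewrite -size_poly_gt0 ltnW.
move: (P0); rewrite EB mulf_eq0 negb_or => /andP[A0 B0].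
have sA : (size A < size P)%N.
  rewrite -sqA -sQ ltn_neqAle dvdp_leq ?andbT ?map_poly_eq0_id0 ?intr_eq0 ?lead_coef_eq0 //.
  by rewrite dvdp_size_eqp.
apply: nAB; exists A, B; split=> //.
have : (0 < size A)%N by rewrite size_poly_gt0.
move: sq; rewrite sqA EB size_mul //.
by move: (size A) (size B) => u v; lia.
Qed.

Lemma irreducible_polyZ (F : fieldType) (c : F) (p : {poly F}) :
  c != 0 -> irreducible_poly (c *: p) -> irreducible_poly p.
Proof.
move=> c0 [sp irr]; split; first by rewrite -(size_scale p c0).
move=> q sq qp; rewrite -(eqp_rtrans (eqp_scale p c0)).
by apply: irr => //; rewrite dvdpZr.
Qed.

(** Descent on the size: the primitive part of an irreducible polynomial is minimal; otherwise [a]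
    is a root of one of two shorter factors. The cofactor [r] is kept so that [height_mul] can bound
    the height of [M]. *)
Lemma exists_minpolyZ (F : numFieldType) (P : {poly int}) (a : F) :
  P != 0 -> root (map_poly intr P) a ->
  exists M r : {poly int}, is_minpolyZ M a /\ P = M * r.
Proof.
have [k] := ubnP (size P); elim: k P => // k IH P sP P0 rP.
have sP1 : (1 < size P)%N.
  rewrite ltnNge; apply/negP => /size1_polyC EP; move: rP P0.
  by rewrite EP map_polyC rootC intr_eq0 polyC_eq0 => ->.
have [irr|nirr] := pselect (irreducible_poly (map_poly (intr : int -> rat) P)).
  have c0 : zcontents P != 0 by rewrite zcontents_eq0.
  have c0' (K : numFieldType) : (zcontents P)%:~R != 0 :> K by rewrite intr_eq0.
  exists (zprimitive P), (zcontents P)%:P; split; last first.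
    by rewrite mulrC mul_polyC -zpolyEprim.
  split; first by rewrite zcontents_primitive P0.
    by apply: (irreducible_polyZ (c0' rat)); rewrite -map_polyZ -zpolyEprim.
  by move: rP; rewrite {1}(zpolyEprim P) map_polyZ rootZ ?c0'.
have [A [B [EP sA sB]]] := reducible_factor sP1 nirr.
move: (P0) rP; rewrite EP mulf_eq0 negb_or rmorphM rootM => /andP[A0 B0] /orP[] r.
  have [M [q [hM Eq]]] := IH A (leq_trans sA sP) A0 r.
  by exists M, (q * B); split=> //; rewrite mulrA -Eq.
have [M [q [hM Eq]]] := IH B (leq_trans sB sP) B0 r.
by exists M, (A * q); split=> //; rewrite mulrCA -Eq.
Qed.

Lemma minpolyZ_neq0 (F : fieldType) (M : {poly int}) (a : F) :
  is_minpolyZ M a -> M != 0.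
Proof. by case=> /eqP + _ _; apply: contraTneq => ->; rewrite zcontents0. Qed.

(** * Roots close to [xi] *)

Section NearbyRoots.
Variables (R : realType) (n : nat) (xi : R).
Hypothesis xi_tr : transcendental xi.

Local Notation ev P := ((map_poly intr P).[xi] : R).
Local Notation dev P := ((map_poly intr P)^`().[xi] : R).
Local Notation h P := ((height P)%:R : R).
Local Notation dist a := (ComplexField.Normc.normc (xi%:C%C - a)).

Lemma ev_neq0 (P : {poly int}) : P != 0 -> ev P != 0.
Proof.
move=> P0; apply/negP => rP; apply: xi_tr.
exists (map_poly intr P).
  by rewrite map_poly_eq0_id0 ?intr_eq0 ?lead_coef_eq0.
rewrite -map_poly_comp /= (eq_map_poly (g := intr)) //.
by move=> z /=; rewrite ratr_int.
Qed.

Lemma ev_gt0 (P : {poly int}) : P != 0 -> 0 < `|ev P|.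
Proof. by rewrite normr_gt0; apply: ev_neq0. Qed.

Lemma normc_ge0 (z : R[i]) : 0 <= ComplexField.Normc.normc z.
Proof. by case: z => a b; apply: sqrtr_ge0. Qed.

Lemma dist_gt0 (a : R[i]) (P : {poly int}) : P != 0 ->
  root (map_poly intr P) a -> 0 < dist a.
Proof.
move=> P0 rP; rewrite lt_def normc_ge0 andbT.
apply/eqP => /ComplexField.Normc.eq0_normc /eqP; rewrite subr_eq0 => /eqP Ea.
move: rP; rewrite -Ea => rP; have /eqP[] := ev_neq0 P0.
apply/eqP; rewrite -/(root _ _) -(fmorph_root (real_complex R)) -map_poly_comp /=.
rewrite (eq_map_poly (g := intr)) // => z /=.
by rewrite rmorph_int.
Qed.

(** [p' / p] at [z] is a sum of [size s] terms [1 / (z - a)], each of modulus at most [1 / r];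
    clearing denominators covers the case [r = 0]. *)
Lemma deriv_prod_XsubC_le (s : seq R[i]) (z : R[i]) (r : R) : 0 <= r ->
  (forall a, a \in s -> r <= ComplexField.Normc.normc (z - a)) ->
  let p := \prod_(a <- s) ('X - a%:P) in
  ComplexField.Normc.normc p^`().[z] * r
    <= (size s)%:R * ComplexField.Normc.normc p.[z].
Proof.
move=> r0; elim: s => [|a s IH] ra.
  by rewrite /= big_nil -[1]/(1%:P) derivC horner0 ComplexField.Normc.normc0 mul0r mul0r.
rewrite /= big_cons; set p := \prod_(b <- s) _.
have {}IH : ComplexField.Normc.normc p^`().[z] * r
    <= (size s)%:R * ComplexField.Normc.normc p.[z].
  by apply: IH => b bs; apply: ra; rewrite inE bs orbT.
rewrite derivM derivXsubC mul1r !hornerE.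
have {}ra : r <= ComplexField.Normc.normc (z - a) by apply: ra; rewrite mem_head.
rewrite ComplexField.Normc.normcM.
have := @le_normcD R p.[z] ((z - a) * p^`().[z]).
rewrite ComplexField.Normc.normcM -natr1.
move: ra IH (normc_ge0 p.[z]) (normc_ge0 (z - a)) (normc_ge0 p^`().[z]).
set A := ComplexField.Normc.normc (z - a); set B := ComplexField.Normc.normc p.[z].
set D := ComplexField.Normc.normc p^`().[z].
move: (ComplexField.Normc.normc _) => N ra IH B0 A0 D0 hN.
apply: (@le_trans _ _ ((B + A * D) * r)); first by rewrite ler_wpM2r.
have h1 : A * (D * r) <= A * ((size s)%:R * B) by rewrite ler_wpM2l.
have h2 : B * r <= B * A by rewrite ler_wpM2l.
rewrite [X in X <= _](_ : _ = B * r + A * (D * r)); last by ring.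
by rewrite [X in _ <= X](_ : _ = B * A + A * ((size s)%:R * B)); [lra|ring].
Qed.

Lemma seq_argmin (T : eqType) (f : T -> R) (s : seq T) : s != [::] ->
  exists2 a, a \in s & forall b, b \in s -> f a <= f b.
Proof.
elim: s => // a s IH _; have [->|s0] := eqVneq s [::].
  by exists a => [|b]; rewrite ?mem_head // inE => /eqP ->.
have [c cs hc] := IH s0; have [le_ac|/ltW le_ca] := leP (f a) (f c).
  exists a => [|b]; rewrite ?mem_head // inE => /orP[/eqP -> //|bs].
  exact: le_trans (hc _ bs).
exists c => [|b]; first by rewrite inE cs orbT.
by rewrite inE => /orP[/eqP -> //|/hc].
Qed.

(* The logarithmic derivative is the sum of at most [n] terms [1/(xi - a)]. *)
Lemma near_root (P : {poly int}) : (size P <= n.+1)%N -> dev P != 0 ->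
  exists2 a : R[i],
    root (map_poly intr P) a & dist a * `|dev P| <= n%:R * `|ev P|.
Proof.
move=> sP dP0; pose p := map_poly (intr : int -> R[i]) P.
have pE : p = map_poly (real_complex R) (map_poly intr P).
  by rewrite -map_poly_comp; apply: eq_map_poly => z /=; rewrite rmorph_int.
have evE : p.[xi%:C%C] = (ev P)%:C%C by rewrite pE horner_map.
have devE : p^`().[xi%:C%C] = (dev P)%:C%C by rewrite pE deriv_map horner_map.
have [s ps] := closed_field_poly_normal p.
have P0 : P != 0 by apply: contraNneq dP0 => ->; rewrite rmorph0 deriv0 horner0.
have lp0 : lead_coef p != 0.
  by rewrite lead_coef_eq0 map_poly_eq0_id0 ?intr_eq0 ?lead_coef_eq0.
have s0 : s != [::].
  apply: contraNneq dP0 => s0; apply/eqP.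
  have : (dev P)%:C%C = 0 :> R[i].
    by rewrite -devE ps s0 big_nil -mul_polyC mulr1 derivC horner0.
  by move=> /(@complexI R).
have [a as_ ha] := seq_argmin (fun a => dist a) s0.
exists a; first by rewrite -/p ps rootZ // root_prod_XsubC.
have ss : (size s <= n)%N.
  rewrite -ltnS -(size_prod_XsubC s id) -(size_scale _ lp0) -ps.
  by rewrite size_map_poly_id0 // intr_eq0 lead_coef_eq0.
have := deriv_prod_XsubC_le (normc_ge0 (xi%:C%C - a)) ha.
have normR (x : R) : ComplexField.Normc.normc x%:C%C = `|x|.
  by rewrite /= expr0n addr0 sqrtr_sqr.
rewrite /= -(normR (dev P)) -(normR (ev P)) -evE -devE ps derivZ !hornerZ.
rewrite !ComplexField.Normc.normcM.
set q := \prod_(_ <- _) _; set L := ComplexField.Normc.normc (lead_coef p) => H.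
have L0 : 0 <= L := normc_ge0 _.
have := ler_wpM2l L0 H; set N := ComplexField.Normc.normc q.[_].
have : L * ((size s)%:R * N) <= L * (n%:R * N).
  by rewrite ler_wpM2l // ler_wpM2r ?normc_ge0 // ler_nat.
lra.
Qed.

(** The minimal polynomial of the root found by [near_root] divides [P], and Gelfond's inequality
    bounds the height of a divisor. *)
Lemma near_algebraic : exists2 C : R, 0 < C &
  forall P : {poly int}, (size P <= n.+1)%N -> dev P != 0 ->
  exists (a : R[i]) (M : {poly int}),
    [/\ is_minpolyZ M a, (size M <= n.+1)%N, 0 < dist a,
        dist a * `|dev P| <= n%:R * `|ev P| & h M <= C * h P].
Proof.
have [C C0 HC] := height_mul R n; exists C => // P sP dP0.
have P0 : P != 0 by apply: contraNneq dP0 => ->; rewrite rmorph0 deriv0 horner0.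
have [a ra da] := near_root sP dP0.
have [M [r [Ma EP]]] := exists_minpolyZ P0 ra.
move: (P0); rewrite EP mulf_eq0 negb_or => /andP[M0 r0].
have sMr := size_factors M0 r0; rewrite -EP in sMr.
have [sM sr] : (size M <= n.+1)%N /\ (size r <= n.+1)%N.
  by split; apply: leq_trans sP; case: sMr.
exists a, M; split=> //; first exact: dist_gt0 ra.
  by rewrite -EP.
apply: le_trans (HC M r sM sr M0 r0).
by rewrite ler_peMr // height_ge1.
Qed.

End NearbyRoots.

(** * A bound for Sylvester determinants *)

(* [Sylvester_mx] with its dimensions as parameters, so that polynomials can
   be replaced by others of the same size without a cast. *)
Definition sylvester (S : nzRingType) (m k : nat) (p q : {poly S}) : 'M[S]_(m + k) :=
  col_mx (lin1_mx (poly_rV \o p \o* rVpoly)) (lin1_mx (poly_rV \o q \o* rVpoly)).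

Lemma resultantE (S : nzRingType) (p q : {poly S}) m k :
  size q = m.+1 -> size p = k.+1 -> resultant p q = \det (sylvester m k p q).
Proof. by move=> sq sp; rewrite /resultant /Sylvester_mx sq sp. Qed.

Lemma sylvesterEl (S : nzRingType) m k (p q : {poly S}) i j :
  sylvester m k p q (lshift k i) j = p`_(j - i) *+ (i <= j).
Proof.
by rewrite /sylvester col_mxEu !mxE /= rVpoly_delta coefXnM ltnNge if_neg -mulrb.
Qed.

Lemma sylvesterEr (S : nzRingType) m k (p q : {poly S}) i j :
  sylvester m k p q (rshift m i) j = q`_(j - i) *+ (i <= j).
Proof.
by rewrite /sylvester col_mxEd !mxE /= rVpoly_delta coefXnM ltnNge if_neg -mulrb.
Qed.

Lemma map_sylvester (S S' : nzRingType) (f : {rmorphism S -> S'}) m k p q :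
  map_mx f (sylvester m k p q) = sylvester m k (map_poly f p) (map_poly f q).
Proof.
rewrite /sylvester map_col_mx; congr (col_mx _ _);
  by apply: map_lin1_mx => v; rewrite /= map_poly_rV rmorphM /= map_rVpoly.
Qed.

Section Shift.
Variables (S : idomainType) (c : S).
Let shift (p : {poly S}) := p \Po ('X + c%:P).
Let T d : 'M[S]_d := \matrix_i poly_rV (('X + c%:P) ^+ i).

Let XaddCE : 'X + c%:P = 'X - (- c)%:P.
Proof. by rewrite rmorphN opprK. Qed.

Let shiftXn i : shift 'X^i = ('X + c%:P) ^+ i.
Proof. by rewrite /shift rmorphXn /= comp_polyX. Qed.

Let mulT d (v : 'rV_d) : v *m T d = poly_rV (shift (rVpoly v)).
Proof.
rewrite mulmx_sum_row {2}(row_sum_delta v) /shift !linear_sum /=.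
apply: eq_bigr => i _; rewrite !linearZ /= rVpoly_delta -/(shift _) shiftXn.
by rewrite rowK.
Qed.

Let detT d : \det (T d) = 1.
Proof.
rewrite det_trig.
  rewrite big1 // => i _; rewrite !mxE -[LHS]/(('X + c%:P) ^+ i)`_i.
  rewrite XaddCE; have := monic_exp i (monicXsubC (- c)); rewrite monicE => /eqP.
  by rewrite lead_coefE size_exp_XsubC.
apply/is_trig_mxP => i j lt_ij; rewrite !mxE nth_default //.
by rewrite XaddCE size_exp_XsubC.
Qed.

(** [T] is the matrix of the translation in the monomial basis. Translation respects products, so
    [T] intertwines multiplication by [r] with multiplication by its translate; being triangular
    with unit diagonal, it does not affect determinants. *)
Lemma det_sylvester_shift m k (p q : {poly S}) :
  (size p <= k.+1)%N -> (size q <= m.+1)%N ->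
  \det (sylvester m k (shift p) (shift q)) = \det (sylvester m k p q).
Proof.
move=> sp sq.
have E d d' (r : {poly S}) : (size r <= d'.+1)%N -> (d + d' <= m + k)%N ->
    T d *m lin1_mx (poly_rV \o shift r \o* rVpoly) =
    lin1_mx (poly_rV \o r \o* rVpoly) *m T (m + k).
  move=> sr le_d; apply/row_matrixP => i; rewrite !row_mul !rowK.
  rewrite mul_rV_lin1 /= mulT poly_rV_K ?XaddCE ?size_exp_XsubC // -XaddCE.
  rewrite /row; set w := (X in _ = poly_rV (shift (rVpoly X))).
  have -> : w = poly_rV (r * 'X^i).
    by apply/rowP => j; rewrite !mxE /= rVpoly_delta mulrC.
  rewrite poly_rV_K; first by rewrite -shiftXn /shift rmorphM mulrC.
  apply: (leq_trans (size_polyMleq _ _)); rewrite size_polyXn addnS /=.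
  by move: sr le_d (ltn_ord i); move: (size r) => z; lia.
have [Ep Eq] := (E m k p sp (leqnn _), E k m q sq (eq_leq (addnC _ _))).
have : block_mx (T m) 0 0 (T k) *m sylvester m k (shift p) (shift q)
     = sylvester m k p q *m T (m + k).
  by rewrite /sylvester mul_block_col !mul0mx addr0 add0r Ep Eq mul_col_mx.
by move=> /(congr1 determinant); rewrite !det_mulmx det_ublock !detT !mul1r mulr1.
Qed.

End Shift.


(** In each term of the Leibniz expansion the entries of columns [c0], [c1], [c2] lie in distinct
    rows and contribute at most [B], the other [N - 3] entries at most [K] each. The factor [K ^+ 3]
    avoids a subtraction in the exponent. *)
Lemma det_le_three_columns (F : realFieldType) N (A : 'M[F]_N) (K B : F)
    (c0 c1 c2 : 'I_N) : c1 != c0 -> c2 != c0 -> c2 != c1 -> 0 < K ->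
  (forall i j, `|A i j| <= K) ->
  (forall r0 r1 r2, r1 != r0 -> r2 != r0 -> r2 != r1 ->
     `|A r0 c0| * `|A r1 c1| * `|A r2 c2| <= B) ->
  `|\det A| * K ^+ 3 <= N`!%:R * (K ^+ N * B).
Proof.
move=> c10 c20 c21 K0 AK AB.
have split3 (f : 'I_N -> F) : \prod_i f i =
    f c0 * f c1 * f c2 * \prod_(i | [&& i != c0, i != c1 & i != c2]) f i.
  rewrite (bigD1 c0) //= (bigD1 c1) //= (bigD1 c2) /=; last by rewrite c20 c21.
  by rewrite !mulrA; under eq_bigl => i do rewrite -andbA.
have KN : K ^+ N = K ^+ 3 * \prod_(i | [&& i != c0, i != c1 & i != c2]) K.
  by rewrite -[N in K ^+ N]card_ord -prodr_const split3 !exprS expr0 mulr1 mulrA.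
rewrite -det_tr /determinant.
apply: (@le_trans _ _ (\sum_(s : 'S_N) (K ^+ N * B))); last first.
  by rewrite big_const cardT -cardE card_Sn iter_addr_0 [leRHS]mulr_natl.
rewrite -ler_pdivlMr ?exprn_gt0 // mulr_suml.
apply: (le_trans (ler_norm_sum _ _ _)); apply: ler_sum => s _.
rewrite normrM normrX normrN1 expr1n mul1r normr_prod split3.
rewrite KN; set W := \prod_(_ | _) K.
rewrite [leRHS](_ : _ = B * W); last by field; rewrite gt_eqF.
rewrite !mxE.
have si (i j : 'I_N) : i != j -> s i != s j by rewrite (inj_eq perm_inj).
apply: ler_pM; rewrite ?mulr_ge0 ?prodr_ge0 //; first exact: AB (si _ _ _) (si _ _ _) (si _ _ _).
by apply: ler_prod => i _; rewrite mxE normr_ge0 AK.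
Qed.

Lemma det_mx2 (S : comNzRingType) (A : 'M[S]_2) :
  \det A = A 0 0 * A 1 1 - A 0 1 * A 1 0.
Proof.
have l00 : lift (0 : 'I_2) (0 : 'I_1) = 1 by apply: val_inj.
have l10 : lift (1 : 'I_2) (0 : 'I_1) = 0 by apply: val_inj.
rewrite (expand_det_row A 0) !big_ord_recl big_ord0 /cofactor !det_mx11 !mxE /=.
by rewrite l00 l10 expr0 expr1 addr0 mul1r mulN1r mulrN.
Qed.

Section SylvesterBound.
Variables (F : realFieldType) (m k : nat) (p q : {poly F}) (K a b D : F).
Hypotheses (K0 : 0 < K) (D0 : 0 <= D) (a0 : 0 <= a) (ab : a <= b).
Hypotheses (pK : forall i, `|p`_i| <= K) (qK : forall i, `|q`_i| <= K).
Hypotheses (p0 : `|p`_0| <= a) (q0 : `|q`_0| <= b).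
Hypotheses (p1 : `|p`_1| <= a * D) (q1 : `|q`_1| <= b * D).

(** Only the first row of each block meets column [0], in a constant term. If column [1] or [2]
    supplies a second constant term, the product is at most [K * b ^+ 2]. Otherwise both supply
    linear coefficients, and column [1] uses the first row of the other block; so one of the first
    two factors comes from [p], whence [a * b ^+ 2 * D ^+ 2]. *)
Lemma det_sylvester_le : (2 < m + k)%N ->
  `|\det (sylvester m k p q)| * K ^+ 3 <=
  (m + k)`!%:R * (K ^+ (m + k) * (K * b ^+ 2 + a * b ^+ 2 * D ^+ 2)).
Proof.
move=> mk.
pose c0 : 'I_(m + k) := Ordinal (ltnW (ltnW mk)).
pose c1 : 'I_(m + k) := Ordinal (ltnW mk).
pose c2 : 'I_(m + k) := Ordinal mk.
pose coef (e : bool) i := if e then p`_i else q`_i.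
(* A row is recorded by its block, [true] for [p], and the power of [X] that multiplies the
   polynomial in it. *)
pose rowid (r : 'I_(m + k)) : bool * nat :=
  match fintype.split r with inl i => (true, i : nat) | inr i => (false, i : nat) end.
have rowid_inj : injective rowid.
  move=> r r' H; apply: (can_inj (@fintype.splitK m k)); move: H; rewrite /rowid.
  by case: (fintype.split r) => i; case: (fintype.split r') => j [] // /val_inj ->.
have entry r j : sylvester m k p q r j =
    coef (rowid r).1 (j - (rowid r).2)%N *+ ((rowid r).2 <= j)%N.
  rewrite /rowid -{1}(fintype.splitK r).
  by case: (fintype.split r) => i /=; rewrite ?sylvesterEl ?sylvesterEr.
have b0 : 0 <= b := le_trans a0 ab.
have coefK e i : `|coef e i| <= K by rewrite /coef; case: e.
have coef0 e : `|coef e 0%N| <= b by rewrite /coef; case: e => //; apply: le_trans ab.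
set B := K * b ^+ 2 + _.
have B2 : 0 <= a * b ^+ 2 * D ^+ 2 by rewrite !mulr_ge0 ?exprn_ge0.
have B1 : 0 <= K * b ^+ 2 by rewrite !mulr_ge0 ?exprn_ge0 // ltW.
have B0 : 0 <= B by rewrite /B; lra.
have h1 u v x : 0 <= u -> 0 <= v -> 0 <= x -> u <= b -> v <= b -> x <= K ->
    u * v * x <= B.
  move=> u0 v0 x0 ub vb xK; apply: (@le_trans _ _ (b * b * K)).
    by apply: ler_pM; rewrite ?mulr_ge0 //; apply: ler_pM.
  by rewrite /B expr2; lra.
have h2 u v w : 0 <= u -> 0 <= v -> 0 <= w ->
    [\/ [/\ u <= a, v <= b * D & w <= b * D], [/\ u <= a, v <= b * D & w <= a * D],
        [/\ u <= b, v <= a * D & w <= b * D] | [/\ u <= b, v <= a * D & w <= a * D]] ->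
    u * v * w <= B.
  move=> u0 v0 w0 H; apply: (@le_trans _ _ (a * b ^+ 2 * D ^+ 2)); last by rewrite /B; lra.
  have aD : a * D <= b * D by rewrite ler_wpM2r.
  rewrite (_ : a * b ^+ 2 * D ^+ 2 = a * (b * D) * (b * D)); last by ring.
  have {H} [[H1 H2 H3]|[H1 H2 H3]] : [/\ u <= a, v <= b * D & w <= b * D] \/
      [/\ u <= b, v <= a * D & w <= b * D].
    by case: H => -[H1 H2 H3]; [left|left|right|right]; split=> //; apply: le_trans aD.
    by apply: ler_pM; rewrite ?mulr_ge0 //; apply: ler_pM.
  rewrite (_ : a * (b * D) = b * (a * D)); last by ring.
  by apply: ler_pM; rewrite ?mulr_ge0 //; apply: ler_pM.
apply: (@det_le_three_columns _ _ _ _ _ c0 c1 c2) => //.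
  by move=> i j; rewrite entry; case: (_ <= _)%N; rewrite ?mulr0n ?mulr1n ?normr0 ?coefK ?(ltW K0).
move=> r0 r1 r2; rewrite -!(inj_eq rowid_inj) !entry.
case: (rowid r0) => e0 i0; case: (rowid r1) => e1 i1; case: (rowid r2) => e2 i2 /=.
rewrite !xpair_eqE.
case: i0 => [|i0] /=; last by rewrite !mulr0n normr0 !mul0r.
case: i1 => [|[|i1]] /=; last by rewrite !mulr0n normr0 mulr0 mul0r.
  case: i2 => [|[|[|i2]]] /=; last by rewrite !mulr0n normr0 mulr0.
  - by case: e0; case: e1; case: e2.
  - by case: e0; case: e1; case: e2 => // _ _ _; rewrite !mulr1n; apply: h2 => //;
      [constructor 2|constructor 1|constructor 4|constructor 3].
  - move=> _ _ _; rewrite !mulr1n mulrAC; exact: h1.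
move=> _ _ _; rewrite !mulr1n; apply: h1 => //.
by case: (_ <= _)%N; rewrite ?mulr0n ?mulr1n ?normr0 ?coefK ?(ltW K0).
Qed.

(** For two linear polynomials there are only two columns, and the determinant is
    [p_0 q_1 - p_1 q_0]. *)
Lemma det_sylvester_le_linear : m = 1%N -> k = 1%N ->
  `|\det (sylvester m k p q)| <= 2 * (a * b * D).
Proof.
move=> m1 k1; move: (sylvester m k p q) (@sylvesterEl _ m k p q) (@sylvesterEr _ m k p q).
rewrite m1 k1 => A Al Ar.
have -> : \det A = A 0 0 * A 1 1 - A 0 1 * A 1 0 := det_mx2 A.
have b0 : 0 <= b := le_trans a0 ab.
have := (Al 0 0, Al 0 1, Ar 0 0, Ar 0 1) => /=.
rewrite (_ : lshift 1 (0 : 'I_1) = 0 :> 'I_2); last exact: val_inj.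
rewrite (_ : rshift 1 (0 : 'I_1) = 1 :> 'I_2); last exact: val_inj.
move=> [[[-> ->] ->] ->]; rewrite !mulr1n /=.
apply: (le_trans (ler_normB _ _)); rewrite !normrM.
have h1 : `|p`_0| * `|q`_1| <= a * (b * D) by apply: ler_pM.
have h2 : `|p`_1| * `|q`_0| <= (a * D) * b by apply: ler_pM.
by rewrite ?subn0; lra.
Qed.

End SylvesterBound.

(** * Exponents as effective inequalities *)

Local Open Scope classical_set_scope.
Local Open Scope ring_scope.

Lemma powR_large (R : realType) (C d : R) : 0 < d ->
  exists M : R, forall x, M < x -> C < x `^ d.
Proof.
move=> d0; exists ((`|C| + 1) `^ d^-1) => x Mx.
have C0 : 0 <= `|C| + 1 by rewrite addr_ge0.
have M0 := powR_ge0 (`|C| + 1) d^-1.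
have : ((`|C| + 1) `^ d^-1) `^ d < x `^ d.
  by apply: gt0_ltr_powR; rewrite ?nnegrE //; apply: ltW (le_lt_trans M0 Mx).
rewrite -powRrM mulVf ?gt_eqF // powRr1 //; apply: le_lt_trans.
by rewrite (le_trans (ler_norm _)) // lerDl.
Qed.

Lemma powRN_anti (R : realType) (w x y : R) :
  0 <= w -> 0 < x -> x <= y -> y `^ (- w) <= x `^ (- w).
Proof.
move=> w0 x0 xy; have y0 := lt_le_trans x0 xy.
rewrite !powRN lef_pV2 ?posrE ?powR_gt0 //.
by apply: ge0_ler_powR; rewrite ?nnegrE // ltW.
Qed.

Lemma powRN_le1 (R : realType) (w x : R) : 0 <= w -> 1 <= x -> x `^ (- w) <= 1.
Proof. by move=> w0 x1; have := powRN_anti w0 ltr01 x1; rewrite powR1. Qed.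

Lemma finite_pos_lower_bound (R : realType) (T : choiceType) (A : set T) (f : T -> R) :
  finite_set A -> (forall x, A x -> 0 < f x) ->
  exists2 c, 0 < c & forall x, A x -> c <= f x.
Proof.
move=> /finite_seqP[s ->] f0.
suff [c c0 Hc] : exists2 c, 0 < c & forall x, x \in s -> c <= f x by exists c.
elim: s f0 => [|a s IH] f0; first by exists 1.
have [|c c0 Hc] := IH; first by move=> x xs; apply: f0; rewrite /= inE xs orbT.
exists (Num.min c (f a)); first by rewrite lt_min c0 f0 //= mem_head.
by move=> x; rewrite inE ge_min => /orP[/eqP ->|/Hc ->//]; rewrite lexx orbT.
Qed.

Lemma finite_bounded_height (n N : nat) :
  finite_set [set P : {poly int} | (size P <= n.+1)%N /\ (height P <= N)%N].
Proof.
pose g (f : {ffun 'I_n.+1 -> 'I_(N + N).+1}) : {poly int} :=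
  \poly_(i < n.+1) ((f (inord i))%:Z - N%:Z).
apply: (@sub_finite_set _ _ (g @` setT)); last exact/finite_image/finite_finset.
move=> P [sP hP]; exists [ffun i : 'I_n.+1 => inord (absz ((P`_i)%R + N%:Z))] => //.
apply/polyP => i; rewrite coef_poly; case: ltnP => [lt_i|le_i]; last first.
  by rewrite nth_default // (leq_trans sP).
have := leq_trans (coef_le_height P i) hP => hi.
rewrite ffunE inordK inordK //; last by lia.
lia.
Qed.

(** * Powers of the height in the determinant bounds *)

Section Decay.
Variables (R : realType) (H w v W bet E : R).
Hypothesis H0 : 0 < H.

Let powE x y : H `^ (x + y) = H `^ x * H `^ y.
Proof. by rewrite powRD // (gt_eqF H0) implybT. Qed.

(** Here and below [H^-w], [bet H^-v] and [E H^(W+1)] stand for [a], [b] and [D] of the Sylvester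
    bounds; the exponent in the hypothesis is the net saving in [H]. *)
Lemma decay_linear : 2 * bet * E < H `^ (w + v - W - 1) ->
  2 * (H `^ (- w) * (bet * H `^ (- v)) * (E * H `^ (W + 1))) < 1.
Proof.
set d := w + v - W - 1 => Hd.
rewrite [X in 2 * X](_ : _ = bet * E * H `^ (- d)); last first.
  rewrite /d (_ : - (w + v - W - 1) = - w + (- v + (W + 1))); last by ring.
  by rewrite !powE; ring.
by rewrite powRN !mulrA ltr_pdivrMr ?powR_gt0 // mul1r.
Qed.

(** With [K = S * H] the two summands of the Sylvester bound carry [H] to the powers [3 - d1] and
    [3 - d2]; the factor [2] in the hypotheses keeps each below [H ^+ 3 / 2]. *)
Lemma decay_sylvester (n : nat) (S F : R) : F = (2 * n)`!%:R * S ^+ (2 * n) ->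
  2 * F * S * bet ^+ 2 < H `^ (2 * v + 2 - 2 * n%:R) ->
  2 * F * bet ^+ 2 * E ^+ 2 < H `^ (w + 2 * v - 2 * W - 2 * n%:R + 1) ->
  (2 * n)`!%:R * ((S * H) ^+ (2 * n) * (S * H * (bet * H `^ (- v)) ^+ 2 +
    H `^ (- w) * (bet * H `^ (- v)) ^+ 2 * (E * H `^ (W + 1)) ^+ 2)) < H ^+ 3.
Proof.
set d1 := 2 * v + 2 - _; set d2 := w + 2 * v - _ - _ + 1 => FE HZ1 HZ2.
have E1 : H ^+ (2 * n) * (H * (H `^ (- v)) ^+ 2) = H ^+ 3 * H `^ (- d1).
  rewrite -(powR_mulrn (2 * n) (ltW H0)) -(powR_mulrn 3 (ltW H0)) !expr2.
  rewrite -[X in _ * (X * _)](powRr1 (ltW H0)) -!powE natrM; congr (_ `^ _).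
  by rewrite /d1; ring.
have E2 : H ^+ (2 * n) * (H `^ (- w) * (H `^ (- v)) ^+ 2 * (H `^ (W + 1)) ^+ 2)
        = H ^+ 3 * H `^ (- d2).
  rewrite -(powR_mulrn (2 * n) (ltW H0)) -(powR_mulrn 3 (ltW H0)) !expr2.
  rewrite -!powE natrM; congr (_ `^ _).
  by rewrite /d2; ring.
rewrite [ltLHS](_ : _ =
    H ^+ 3 * (F * S * bet ^+ 2 * H `^ (- d1) + F * bet ^+ 2 * E ^+ 2 * H `^ (- d2))); last first.
  transitivity (F * S * bet ^+ 2 * (H ^+ 3 * H `^ (- d1))
                + F * bet ^+ 2 * E ^+ 2 * (H ^+ 3 * H `^ (- d2))); last by ring.
  by rewrite -E1 -E2 FE !exprMn; ring.
rewrite -[ltRHS]mulr1 ltr_pM2l ?exprn_gt0 // !powRN.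
move: HZ1 HZ2; set Z2 := H `^ d2; set Z1 := H `^ d1 => HZ1 HZ2.
have Z10 : 0 < Z1 by rewrite powR_gt0.
have Z20 : 0 < Z2 by rewrite powR_gt0.
have : 2 * F * S * bet ^+ 2 / Z1 < 1 by rewrite ltr_pdivrMr // mul1r.
have : 2 * F * bet ^+ 2 * E ^+ 2 / Z2 < 1 by rewrite ltr_pdivrMr // mul1r.
by lra.
Qed.

End Decay.

(** * The resultant inequality between the exponents *)

Section Exponents.
Variables (R : realType) (n : nat) (xi : R).
Hypothesis xi_tr : transcendental xi.

Local Notation ev P := ((map_poly intr P).[xi] : R).
Local Notation dev P := ((map_poly intr P)^`().[xi] : R).
Local Notation h P := ((height P)%:R : R).
Local Notation dist a := (ComplexField.Normc.normc (xi%:C%C - a)).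

(* Up to the boundary case, [poly_lower w] means [w_exp <= w] and
   [star_lower w] means [w_star <= w]. *)
Definition poly_lower (w : R) := exists2 c : R, 0 < c &
  forall P : {poly int}, (size P <= n.+1)%N -> P != 0 ->
    c * h P `^ (- w) <= `|ev P|.

Definition star_lower (w : R) := exists2 c : R, 0 < c &
  forall (a : R[i]) (M : {poly int}), is_minpolyZ M a -> (size M <= n.+1)%N ->
    c * h M `^ (- w - 1) <= dist a.

Definition uniform_exp (w : R) := \forall H \near +oo, exists P : {poly int},
  [/\ (size P <= n.+1)%N, 0 < `|ev P| <= H `^ (- w) & h P <= H].

Lemma bounded_height_lower (N : nat) : exists2 c : R, 0 < c &
  forall P : {poly int}, (size P <= n.+1)%N -> (height P <= N)%N -> P != 0 ->
    c <= `|ev P|.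
Proof.
have [||c c0 Hc] := @finite_pos_lower_bound R _
    [set P : {poly int} | ((size P <= n.+1)%N /\ (height P <= N)%N) /\ P != 0]
    (fun P => `|ev P|).
- by apply: sub_finite_set (finite_bounded_height n N) => P [].
- by move=> P [_ P0]; apply: ev_gt0.
by exists c => // P sP hP P0; apply: Hc.
Qed.

Lemma ev_zscale (z : int) (P : {poly int}) : ev (z *: P) = z%:~R * ev P.
Proof. by rewrite map_polyZ hornerZ. Qed.

Lemma norm_intr_ge1 (z : int) : z != 0 -> 1 <= `|z%:~R : R|.
Proof. by move=> z0; rewrite -intr_norm (ler_int _ 1) -gtz0_ge1 normr_gt0. Qed.

Lemma height_zprimitive (P : {poly int}) : h (zprimitive P) <= h P.
Proof.
have [->|P0] := eqVneq P 0; first by rewrite zprimitive0.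
apply: height_ler => // i; apply: le_trans (norm_coef_le_height R P i).
rewrite {2}(zpolyEprim P) coefZ intrM normrM ler_peMl //.
by rewrite norm_intr_ge1 // zcontents_eq0.
Qed.

(** Values at [xi] multiply, and by Gelfond's inequality heights do so up to a constant; hence lower
    bounds for two factors give one for the product. The constant shrinks at each step of the
    induction on the size. *)
Lemma poly_lower_irreducible (w : R) : 0 <= w ->
  (exists2 c : R, 0 < c & forall P : {poly int}, (size P <= n.+1)%N ->
     zcontents P = 1 -> irreducible_poly (map_poly (intr : int -> rat) P) ->
     c * h P `^ (- w) <= `|ev P|) -> poly_lower w.
Proof.
move=> w0 [c c0 Hc]; have [C C0 HC] := height_mul R n.
suff H m : exists2 c' : R, 0 < c' & forall P : {poly int},
    (size P <= m)%N -> (size P <= n.+1)%N -> P != 0 -> c' * h P `^ (- w) <= `|ev P|.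
  by have [c' c'0 Hc'] := H n.+1; exists c' => // P sP; apply: Hc'.
elim: m => [|m [d d0 IH]].
  by exists 1 => // P; rewrite leqn0 size_poly_eq0 => /eqP ->; rewrite eqxx.
have e0 : 0 < d * d * C `^ (- w) by rewrite !mulr_gt0 // powR_gt0.
exists (Num.min (Num.min 1 c) (d * d * C `^ (- w))).
  by rewrite !lt_min ltr01 c0.
move=> P sPm sP P0; have pw0 := powR_ge0 (h P) (- w).
have [sP1|sP1] := leqP (size P) 1.
  apply: (@le_trans _ _ 1).
    rewrite -[leRHS]mul1r ler_pM ?powRN_le1 ?height_ge1 //.
      by rewrite !le_min ler01 !ltW.
    by rewrite !ge_min lexx.
  have EP := size1_polyC sP1; move: P0; rewrite EP polyC_eq0 => z0.
  by rewrite map_polyC hornerC norm_intr_ge1.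
have [irr|nirr] := pselect (irreducible_poly (map_poly (intr : int -> rat) P)).
  apply: (@le_trans _ _ (c * h P `^ (- w))).
    by rewrite ler_wpM2r // !ge_min lexx orbT.
  have z0 : zcontents P != 0 by rewrite zcontents_eq0.
  have := Hc (zprimitive P); rewrite size_zprimitive zcontents_primitive P0 => /(_ sP erefl).
  have irr' : irreducible_poly (map_poly (intr : int -> rat) (zprimitive P)).
    apply: (@irreducible_polyZ _ (zcontents P)%:~R); first by rewrite intr_eq0.
    by rewrite -map_polyZ -zpolyEprim.
  move=> /(_ irr') Hp; rewrite {2}(zpolyEprim P) ev_zscale normrM.
  apply: (@le_trans _ _ `|ev (zprimitive P)|); last by rewrite ler_peMl // norm_intr_ge1.
  apply: le_trans Hp; rewrite ler_pM2l //; apply: powRN_anti (height_zprimitive P) => //.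
  by rewrite ltr0n height_gt0 // zprimitive_eq0.
have [A [B [EP sA sB]]] := reducible_factor sP1 nirr.
have [A0 B0] : A != 0 /\ B != 0 by apply/andP; move: P0; rewrite EP mulf_eq0 negb_or.
have sA' := leq_trans (ltnW sA) sP; have sB' := leq_trans (ltnW sB) sP.
have IA := IH A (leq_trans sA sPm) sA' A0.
have IB := IH B (leq_trans sB sPm) sB' B0.
rewrite {2}EP rmorphM hornerM normrM.
have hA := height_ge1 R A0; have hB := height_ge1 R B0; have hP := height_ge1 R P0.
apply: (@le_trans _ _ ((d * h A `^ (- w)) * (d * h B `^ (- w)))); last first.
  by apply: ler_pM; rewrite ?mulr_ge0 ?powR_ge0 // ltW.
rewrite (_ : _ * _ * (_ * _) = d * d * (h A * h B) `^ (- w)); last first.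
  by rewrite powRM //; ring.
apply: (@le_trans _ _ (d * d * C `^ (- w) * h P `^ (- w))).
  by rewrite ler_wpM2r // !ge_min lexx orbT.
rewrite -mulrA ler_pM2l ?mulr_gt0 // -powRM ?(ltW C0) //.
apply: powRN_anti => //; first by apply: mulr_gt0; lra.
by rewrite {1}EP; apply: HC.
Qed.

(** The root supplied by [near_algebraic] lies within [n |P(xi) / P'(xi)|] of [xi], while
    [star_lower] keeps it at a distance of order at least [h P] to the power [-(w + 1)]. *)
Lemma dev_le (w : R) : 0 <= w -> star_lower w -> exists2 E : R, 0 < E &
  forall P : {poly int}, (size P <= n.+1)%N ->
    `|dev P| <= E * `|ev P| * h P `^ (w + 1).
Proof.
move=> w0 [c c0 Hc]; have [C C0 HC] := near_algebraic n xi_tr.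
have e0 : 0 < (n%:R + 1) / c * C `^ (w + 1).
  by rewrite !mulr_gt0 ?powR_gt0 ?invr_gt0 // ltr_wpDl.
exists ((n%:R + 1) / c * C `^ (w + 1)) => // P sP.
have [->|dP0] := eqVneq (dev P) 0.
  by rewrite normr0 mulr_ge0 ?powR_ge0 // mulr_ge0 // ltW.
have P0 : P != 0 by apply: contraNneq dP0 => ->; rewrite rmorph0 deriv0 horner0.
have [a [M [Ma sM d0 da hM]]] := HC P sP dP0.
have M0 := minpolyZ_neq0 Ma.
have hM1 := height_ge1 R M0; have hP1 := height_ge1 R P0.
have := Hc a M Ma sM; rewrite -opprD.
have : (C * h P) `^ (- (w + 1)) <= h M `^ (- (w + 1)).
  by apply: powRN_anti => //; lra.
rewrite powRN powRM ?(ltW C0) //.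
have Cw : 0 < C `^ (w + 1) by rewrite powR_gt0.
have Pw : 0 < h P `^ (w + 1) by rewrite powR_gt0 // ltr0n height_gt0.
set X := C `^ _ in Cw *; set Y := h P `^ _ in Pw *.
move: (h M `^ _) => Z XYZ cZ.
have le_d : c / (X * Y) <= dist a.
  by apply: le_trans cZ; rewrite ler_pM2l.
rewrite -(ler_pM2l (divr_gt0 c0 (mulr_gt0 Cw Pw))).
apply: (@le_trans _ _ (dist a * `|dev P|)); first by rewrite ler_wpM2r.
apply: (le_trans da).
rewrite [leRHS](_ : _ = (n%:R + 1) * `|ev P|); last by field; rewrite !gt_eqF.
by rewrite ler_wpM2r // lerDl.
Qed.

Lemma shift_coef_le : exists2 S : R, 1 <= S & forall P : {poly int},
  (size P <= n.+1)%N -> forall i,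
    `|(map_poly intr P \Po ('X + xi%:P))`_i| <= S * h P.
Proof.
pose S := \sum_(j < n.+1) \sum_(i < n.+1) `|(('X + xi%:P) ^+ j)`_i|.
have S0 : 0 <= S by apply: sumr_ge0 => j _; apply: sumr_ge0.
exists (1 + S) => [|P sP i]; first by rewrite lerDl.
have sP' : (size (map_poly (intr : int -> R) P) <= n.+1)%N.
  by apply: leq_trans sP; apply: size_poly.
have [le_i|lt_i] := ltnP i n.+1; last first.
  rewrite nth_default ?normr0 ?mulr_ge0 ?addr_ge0 //.
  by rewrite (leq_trans _ lt_i) // size_comp_poly2 // size_XaddC.
apply: (@le_trans _ _ (S * h P)); last by rewrite ler_wpM2r // lerDr.
rewrite coef_comp_poly.
apply: (le_trans (ler_norm_sum _ _ _)).
rewrite (big_ord_widen _ (fun j => `|(map_poly intr P)`_j * (('X + xi%:P) ^+ j)`_i|) sP').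
rewrite big_mkcond mulr_suml; apply: ler_sum => j _.
apply: (@le_trans _ _ (`|(('X + xi%:P) ^+ j)`_i| * h P)).
  case: ifP => _; last by rewrite mulr_ge0.
  by rewrite normrM mulrC ler_wpM2l // coef_map norm_coef_le_height.
rewrite ler_wpM2r // (bigD1 (Ordinal le_i)) //= lerDl.
exact: sumr_ge0.
Qed.

Lemma shift_coef0 (P : {poly int}) : (map_poly intr P \Po ('X + xi%:P))`_0 = ev P.
Proof. by rewrite -horner_coef0 horner_comp !hornerE. Qed.

Lemma shift_coef1 (P : {poly int}) : (map_poly intr P \Po ('X + xi%:P))`_1 = dev P.
Proof.
set p := _ \Po _; have -> : p`_1 = p^`()`_0 by rewrite coef_deriv mulr1n.
rewrite -horner_coef0 /p deriv_comp hornerM horner_comp.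
by rewrite derivD derivX derivC !hornerE.
Qed.

(** Translation preserves the determinant, which is therefore an integer, the resultant; were it
    zero, [P] and [Q] would share a factor, and irreducibility makes that factor [P] up to a
    constant. *)
Lemma irreducible_resultant_ge1 (P Q : {poly int}) (m k : nat) :
  irreducible_poly (map_poly (intr : int -> rat) P) ->
  ~~ (map_poly (intr : int -> rat) P %| map_poly intr Q) ->
  size Q = m.+1 -> size P = k.+1 ->
  1 <= `|\det (sylvester m k (map_poly intr P \Po ('X + xi%:P))
                             (map_poly intr Q \Po ('X + xi%:P)))|.
Proof.
move=> irr ndvd sQ sP.
have sQ' (S : numDomainType) : size (map_poly (intr : int -> S) Q) = m.+1.
  by rewrite size_map_inj_poly //; apply: intr_inj.
have sP' (S : numDomainType) : size (map_poly (intr : int -> S) P) = k.+1.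
  by rewrite size_map_inj_poly //; apply: intr_inj.
rewrite det_sylvester_shift ?sQ' ?sP' // -map_sylvester det_map_mx.
apply: norm_intr_ge1; apply/negP => /eqP det0.
have : resultant (map_poly (intr : int -> rat) P) (map_poly intr Q) == 0.
  by rewrite (resultantE (sQ' rat) (sP' rat)) -map_sylvester det_map_mx det0 rmorph0.
rewrite resultant_eq0; set g := gcdp _ _ => sg.
have gP : g %= map_poly intr P by apply: irr; rewrite ?dvdp_gcdl // gtn_eqF.
by move/negP: ndvd; apply; rewrite -(eqp_dvdl _ gP) dvdp_gcdr.
Qed.

(** Otherwise primitive irreducible polynomials of height above [N] obey the lower bound, those of
    height up to [N] are finitely many, and [poly_lower_irreducible] extends the bound to all
    polynomials. *)
Lemma exists_irreducible_approx (w : R) : 0 <= w -> ~ poly_lower w ->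
  forall N : nat, exists P : {poly int},
    [/\ (size P <= n.+1)%N, zcontents P = 1,
        irreducible_poly (map_poly (intr : int -> rat) P), (N < height P)%N
      & `|ev P| <= h P `^ (- w)].
Proof.
move=> w0 nlow N; apply: contrapT => nP; apply: nlow.
apply: poly_lower_irreducible => //.
have [c c0 Hc] := bounded_height_lower N.
exists (Num.min 1 c) => [|P sP zP irr]; first by rewrite lt_min ltr01.
have P0 : P != 0 by apply: contra_eq_neq zP => ->; rewrite zcontents0.
have [hN|hN] := leqP (height P) N.
  apply: (@le_trans _ _ c); last exact: Hc.
  rewrite -[leRHS]mulr1 ler_pM ?powR_ge0 ?powRN_le1 ?height_ge1 //.
    by rewrite le_min ler01 ltW.
  by rewrite ge_min lexx orbT.
have : ~ `|ev P| <= h P `^ (- w) by move=> H; apply: nP; exists P.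
move=> /negP; rewrite -ltNge => /ltW; apply: le_trans.
by rewrite ler_piMl ?powR_ge0 // ge_min lexx.
Qed.

Lemma exponent_inequality (w v W : R) : (0 < n)%N -> ~ poly_lower w ->
  uniform_exp v -> star_lower W -> 1 <= W -> n%:R - 1 < v -> v <= w ->
  w + 2 * v <= 2 * W + 2 * n%:R - 1.
Proof.
move=> n_gt0 nlow unif star W1 nv vw; rewrite leNgt; apply/negP => lt_w.
have n1 : 1 <= n%:R :> R by rewrite ler1n.
have v0 : 0 < v by lra.
have w0 : 0 <= w by lra.
have W0 : 0 <= W by lra.
have [E E0 HE] := dev_le W0 star.
have [S S1 HS] := shift_coef_le.
have [C C0 HC] := height_mul R n.
have [U [_ HU]] := unif.
(* [Q] is sought with height at most [kap * H]; as [C * kap < 1], Gelfond's inequality then forbids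
   [P] to divide [Q]. The price is the constant [bet]. *)
pose kap := (C + 1)^-1.
have kap0 : 0 < kap by rewrite invr_gt0; lra.
have kap1 : kap <= 1 by rewrite invf_le1; lra.
have Ckap : C * kap < 1 by rewrite -ltr_pdivlMr // div1r invrK; lra.
pose bet := kap `^ (- v).
have bet1 : 1 <= bet.
  by have := powRN_anti (ltW v0) kap0 kap1; rewrite powR1.
(* [d1 > 0] comes from [v > n - 1], [d2 > 0] is the negated claim, and [d3] serves the case of two
   linear polynomials. *)
pose d1 := 2 * v + 2 - 2 * n%:R.
pose d2 := w + 2 * v - 2 * W - 2 * n%:R + 1.
pose d3 := w + v - W - 1.
have d1_gt0 : 0 < d1 by rewrite /d1; lra.
have d2_gt0 : 0 < d2 by rewrite /d2; lra.
(* If [w + v <= W + 1], then [v <= w] gives [w + 2 v <= 3 (W + 1) / 2], contrary to the assumed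
   lower bound since [W >= 1] and [n >= 1]. *)
have d3_gt0 : 0 < d3.
  by rewrite /d3 ltNge; apply/negP => ?; lra.
pose F : R := (2 * n)`!%:R * S ^+ (2 * n).
have F0 : 0 < F.
  by rewrite mulr_gt0 ?ltr0n ?fact_gt0 // exprn_gt0 //; lra.
have [M1 HM1] := powR_large (2 * F * S * bet ^+ 2) d1_gt0.
have [M2 HM2] := powR_large (2 * F * bet ^+ 2 * E ^+ 2) d2_gt0.
have [M3 HM3] := powR_large (2 * bet * E) d3_gt0.
pose M := Num.max (Num.max M1 M2) (Num.max (Num.max M3 1) ((`|U| + 1) / kap)).
have [N MN] : exists N : nat, M <= N%:R.
  exists (Num.bound `|M|); apply: le_trans (ler_norm M) _.
  exact/ltW/archi_boundP.
have [P [sP zP irr hN Pw]] := exists_irreducible_approx w0 nlow N.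
have P0 : P != 0 by apply: contra_eq_neq zP => ->; rewrite zcontents0.
set H := h P in Pw.
have MH : M < H by apply: (le_lt_trans MN); rewrite ltr_nat.
have [MH1 MH2 MH3 H1 HUk] : [/\ M1 < H, M2 < H, M3 < H, 1 < H & (`|U| + 1) / kap < H].
  by move: MH; rewrite /M !gt_max => /andP[/andP[-> ->] /andP[/andP[-> ->] ->]].
have H0 : 0 < H by lra.
have kH1 : `|U| + 1 < kap * H by rewrite mulrC -ltr_pdivrMr.
have [|Q [sQ /andP[evQ0 evQ] hQ]] := HU (kap * H).
  by apply: le_lt_trans kH1; rewrite (le_trans (ler_norm _)) // lerDl.
have Q0 : Q != 0 by apply: contraTneq evQ0 => ->; rewrite rmorph0 horner0 normr0 ltxx.
have kHgt1 : 1 < kap * H by apply: le_lt_trans kH1; rewrite lerDr.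
have sQ1 : (1 < size Q)%N.
  rewrite ltnNge; apply/negP => /size1_polyC EQ; move: Q0 evQ.
  rewrite EQ polyC_eq0 map_polyC hornerC => /norm_intr_ge1 Q1 evQ.
  have : (kap * H) `^ (- v) < 1.
    have : 1 `^ v < (kap * H) `^ v.
      by apply: gt0_ltr_powR; rewrite ?nnegrE //; lra.
    by rewrite powR1 powRN => ?; rewrite invf_lt1 // (lt_trans ltr01).
  by lra.
(* As [P] is primitive, divisibility over the rationals gives an integer cofactor [r], and then
   [H * h r <= C * h Q < H]. *)
have ndvd : ~~ (map_poly (intr : int -> rat) P %| map_poly intr Q).
  rewrite dvdp_rat_int; apply/negP => /dvdpP_int[r EQ].
  have zPP : zprimitive P = P by rewrite {2}(zpolyEprim P) zP scale1r.
  rewrite zPP in EQ.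
  have r0 : r != 0 by apply: contraNneq Q0 => r0; rewrite EQ r0 mulr0.
  have sr : (size r <= n.+1)%N.
    by apply: leq_trans sQ; rewrite EQ; case: (size_factors P0 r0).
  have := HC P r sP sr P0 r0; rewrite -EQ -/H.
  have hr := height_ge1 R r0.
  have : C * h Q <= C * (kap * H) by rewrite ler_pM2l.
  have : H <= H * h r by rewrite ler_peMr // ltW.
  by have := ltr_pM2r H0 (C * kap) 1; rewrite Ckap; lra.
have bE : (kap * H) `^ (- v) = bet * H `^ (- v) by rewrite powRM // ltW.
rewrite bE in evQ.
set a := H `^ (- w) in Pw; set b := bet * H `^ (- v) in evQ.
have a0 : 0 < a by rewrite powR_gt0.
have Hv0 : 0 < H `^ (- v) by rewrite powR_gt0.
have ab : a <= b.
  apply: (@le_trans _ _ (H `^ (- v))); first by apply: ler_powR; lra.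
  by rewrite ler_peMl // ltW.
have b0 : 0 < b by lra.
pose D := E * H `^ (W + 1).
have D0 : 0 < D by rewrite mulr_gt0 // powR_gt0.
have devP : `|dev P| <= a * D.
  apply: (le_trans (HE P sP)); rewrite -/H /D mulrAC mulrC ler_wpM2r //.
  by rewrite mulr_ge0 ?powR_ge0 // ltW.
have hQH : h Q <= H by apply: (le_trans hQ); rewrite ler_piMl // ltW.
have devQ : `|dev Q| <= b * D.
  apply: (le_trans (HE Q sQ)).
  apply: (@le_trans _ _ (E * b * H `^ (W + 1))); last by rewrite /D; lra.
  apply: ler_pM; rewrite ?powR_ge0 ?mulr_ge0 ?(ltW E0) //.
    by rewrite ler_pM2l.
  by apply: ge0_ler_powR; rewrite ?nnegrE ?(ltW H0) //; lra.
have sP1 : (1 < size P)%N.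
  by case: irr => + _; rewrite size_map_inj_poly //; apply: intr_inj.
have [m sQm] : exists m, size Q = m.+2.
  by case: (size Q) sQ1 => [|[|m]] // _; exists m.
have [k sPk] : exists k, size P = k.+2.
  by case: (size P) sP1 => [|[|k]] // _; exists k.
have det1 := irreducible_resultant_ge1 irr ndvd sQm sPk.
pose K := S * H.
have K1 : 1 <= K by rewrite /K -[1]mulr1 ler_pM // ltW.
have K0 : 0 < K := lt_le_trans ltr01 K1.
have pK i : `|(map_poly intr P \Po ('X + xi%:P))`_i| <= K by apply: HS.
have qK i : `|(map_poly intr Q \Po ('X + xi%:P))`_i| <= K.
  by apply: (le_trans (HS Q sQ i)); rewrite ler_wpM2l // (le_trans ler01).
have := Pw; rewrite -shift_coef0 => p0.
have := evQ; rewrite -shift_coef0 => q0.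
have := devP; rewrite -shift_coef1 => p1.
have := devQ; rewrite -shift_coef1 => q1.
(* The degrees are [m + 1] and [k + 1]; two linear polynomials need the separate bound. *)
have [mk|mk] := leqP (m + k) 0.
  have /andP[/eqP m0 /eqP k0] : (m == 0%N) && (k == 0%N) by rewrite -addn_eq0 -leqn0.
  have := det_sylvester_le_linear (ltW a0) ab p0 q0 p1 q1
    (congr1 succn m0) (congr1 succn k0).
  move=> /(le_trans det1); rewrite leNgt => /negP; apply.
  exact: decay_linear (HM3 H MH3).
have mk2 : (2 < m.+1 + k.+1)%N by rewrite addSn addnS !ltnS.
have := det_sylvester_le K0 (ltW D0) (ltW a0) ab pK qK p0 q0 p1 q1 mk2.
set X := K * b ^+ 2 + _; set L := (m.+1 + k.+1)%N.
have LN : (L <= 2 * n)%N.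
  by move: sP sQ; rewrite sPk sQm mul2n -addnn => ? ?; apply: leq_add.
have X0 : 0 <= X.
  apply: addr_ge0; first exact: mulr_ge0 (ltW K0) (sqr_ge0 _).
  apply: mulr_ge0 (sqr_ge0 _); exact: mulr_ge0 (ltW a0) (sqr_ge0 _).
have h1 : L`!%:R * (K ^+ L * X) <= (2 * n)`!%:R * (K ^+ (2 * n) * X).
  apply: ler_pM => //; first exact: mulr_ge0 (exprn_ge0 _ (ltW K0)) X0.
    by rewrite ler_nat leq_fact.
  by apply: (ler_wpM2r X0); apply: (ler_weXn2l K1).
have h2 : (2 * n)`!%:R * (K ^+ (2 * n) * X) < H ^+ 3.
  exact: decay_sylvester (erefl F) (HM1 H MH1) (HM2 H MH2).
have h3 : H ^+ 3 <= K ^+ 3.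
  by rewrite lerXn2r ?nnegrE ?(ltW H0) ?(ltW K0) // ler_peMl // ltW.
have K3 : 0 <= K ^+ 3 by rewrite exprn_ge0 // ltW.
have := ler_wpM2r K3 det1; rewrite mul1r => h4 h5.
by have := lt_le_trans (le_lt_trans (le_trans (le_trans h4 h5) h1) h2) h3; rewrite ltxx.
Qed.

End Exponents.

(** * Dirichlet's box principle *)

Section Dirichlet.
Variables (R : realType) (m : nat) (xi : R).
Local Notation n := m.+1.
Local Notation ev P := ((map_poly intr P).[xi] : R).

(* Pigeonhole on the fractional parts of [P(xi)]; the constant coefficient
   absorbs the integral parts. *)
Lemma dirichlet_box (A B N : nat) : (0 < N)%N -> (N < A.+1 ^ m * B.+1)%N ->
  exists P : {poly int},
    [/\ P != 0, (size P <= n.+1)%N, `|ev P| <= N%:R^-1,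
        forall i, (absz (P`_(i.+2))%R <= A)%N & (absz (P`_1)%R <= B)%N].
Proof.
move=> N0 ltN; have N0' : 0 < N%:R :> R by rewrite ltr0n.
pose T := ({ffun 'I_m -> 'I_A.+1} * 'I_B.+1)%type.
(* The constant coefficient is left at zero, to be supplied by the integral parts; degree [i + 2]
   reads entry [i] of the function, with default zero out of range. *)
pose cf (t : T) (i : nat) : nat := match i with
  | 0 => 0%N | 1 => t.2 | i'.+2 => if insub i' is Some j then t.1 j : nat else 0%N end.
pose q (t : T) : {poly int} := \poly_(i < n.+1) (cf t i)%:Z.
pose fr t := ev (q t) - (Num.floor (ev (q t)))%:~R.
have fr01 t : 0 <= fr t < 1.
  have /andP[h1 h2] := floor_itv (ev (q t)).
  by rewrite /fr subr_ge0 h1 /= ltrBlDl -(intrD _ _ 1).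
have box t : (Num.truncn (N%:R * fr t) < N)%N.
  have /andP[h1 h2] := fr01 t.
  by rewrite truncn_lt_nat ?mulr_ge0 // gtr_pMr.
have /injectivePn[t [t' tt' [Et]]] : ~~ injectiveb (fun t => Ordinal (box t)).
  apply/negP => /injectiveP /leq_card; rewrite card_prod card_ffun !card_ord.
  by rewrite leqNgt ltN.
pose c := Num.floor (ev (q t)) - Num.floor (ev (q t')).
pose P := q t - q t' - c%:P.
have cP i : P`_i.+1 = if (i < n)%N then (cf t i.+1)%:Z - (cf t' i.+1)%:Z else 0.
  by rewrite /P !coefB !coef_poly coefC subr0 ltnS; case: ifP; rewrite ?subrr.
have cfA s i : (cf s i.+2 <= A)%N.
  by rewrite /cf; case: insub => // j; rewrite -ltnS.
exists P; split.
- apply: contraNneq tt' => P0; apply/eqP.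
  have cE i : (i < n)%N -> cf t i.+1 = cf t' i.+1.
    by move=> lt_i; have := cP i; rewrite P0 coef0 lt_i => /esym/eqP; rewrite subr_eq0 => /eqP [].
  case: t t' {Et c P cP P0} cE => [f b] [f' b'] cE; congr pair; last exact/val_inj/(cE 0%N).
  apply/ffunP => j; apply: val_inj; have := cE j.+1; rewrite /cf ltnS ltn_ord valK.
  exact.
- rewrite (leq_trans (size_polyD _ _)) // geq_max size_polyN.
  rewrite (leq_trans (size_polyC_leq1 _)) // andbT.
  by rewrite (leq_trans (size_polyD _ _)) // geq_max size_polyN !size_poly.
- have -> : ev P = fr t - fr t'.
    by rewrite /P !rmorphB /= !map_polyC /= !hornerE /fr; ring.
  have /andP[a1 a2] := fr01 t; have /andP[b1 b2] := fr01 t'.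
  have /andP[] := truncn_itv (mulr_ge0 (ltW N0') a1).
  have /andP[] := truncn_itv (mulr_ge0 (ltW N0') b1).
  rewrite Et -natr1; move: (Num.truncn _)%:R => z h1 h2 h3 h4.
  rewrite -div1r ler_pdivlMr // -[N%:R]gtr0_norm // -normrM ler_norml.
  by apply/andP; split; nra.
- by move=> i; rewrite cP; case: ifP => // _; have := cfA t i; have := cfA t' i;
    move: (cf t _) (cf t' _) => x y; clear; lia.
- rewrite cP /=; move: (ltn_ord t.2) (ltn_ord t'.2).
  by move: (val t.2) (val t'.2) => x y; clear; lia.
Qed.

(** The box principle is applied to the truncations of [G], [G^(w-n+1)] and [G^w]: with [n - 1]
    coefficients of degree at least two, the exponents add up to [w]. The factor [2] pays for
    truncating [G^w]. *)
Lemma dirichlet_real (w G : R) : n%:R <= w -> 1 <= G ->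
  exists P : {poly int},
    [/\ P != 0, (size P <= n.+1)%N, `|ev P| <= 2 * G `^ (- w),
        forall i, `|(P`_(i.+2))%:~R| <= G & `|(P`_1)%:~R| <= G `^ (w - n%:R + 1)].
Proof.
move=> nw G1; have G0 : 0 < G by lra.
have n0 : 0 <= m%:R :> R by [].
have w0 : 0 <= w by apply: le_trans nw.
have Gw1 : 1 <= G `^ w by rewrite -(powRr0 G) ler_powR.
have Gv0 := powR_ge0 G (w - n%:R + 1).
have N0 : (0 < Num.truncn (G `^ w))%N by rewrite truncn_gt0.
have [| P [P0 sP eP Pi P1]] :=
  @dirichlet_box (Num.truncn G) (Num.truncn (G `^ (w - n%:R + 1))) _ N0.
  rewrite -(ltr_nat R) natrM natrX.
  apply: (@le_lt_trans _ _ (G `^ w)); first by rewrite truncn_le; lra.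
  have -> : G `^ w = G ^+ m * G `^ (w - n%:R + 1).
    rewrite -powR_mulrn ?(ltW G0) // -powRD; last by rewrite (gt_eqF G0) implybT.
    by congr (_ `^ _); rewrite -natr1; ring.
  apply: (@le_lt_trans _ _ ((Num.truncn G).+1%:R ^+ m * G `^ (w - n%:R + 1))).
    rewrite ler_wpM2r // lerXn2r ?nnegrE ?(ltW G0) //; exact/ltW/truncnS_gt.
  by rewrite ltr_pM2l ?exprn_gt0 // truncnS_gt.
exists P; split=> //.
- apply: (le_trans eP); rewrite powRN.
  have /andP[_] := truncn_itv (le_trans ler01 Gw1).
  have : 1 <= (Num.truncn (G `^ w))%:R :> R by rewrite ler1n.
  rewrite -natr1; set z : R := (Num.truncn (G `^ w))%:R; move: z (G `^ w) Gw1 => z x x1 z1 xz.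
  rewrite -div1r ler_pdivrMr; last by lra.
  by rewrite mulrAC ler_pdivlMr; lra.
- move=> i; rewrite -intr_norm -abszE -pmulrn.
  apply: (@le_trans _ _ (Num.truncn G)%:R); first by rewrite ler_nat.
  by rewrite truncn_le; lra.
- rewrite -intr_norm -abszE -pmulrn.
  apply: (@le_trans _ _ (Num.truncn (G `^ (w - n%:R + 1)))%:R); first by rewrite ler_nat.
  by rewrite truncn_le.
Qed.

End Dirichlet.

(** * The method of Davenport and Schmidt *)

Section Transference.
Variables (R : realType) (m : nat) (xi : R).
Hypothesis xi_tr : transcendental xi.

Local Notation n := m.+1.
Local Notation ev P := ((map_poly intr P).[xi] : R).
Local Notation dev P := ((map_poly intr P)^`().[xi] : R).
Local Notation h P := ((height P)%:R : R).
Local Notation dist a := (ComplexField.Normc.normc (xi%:C%C - a)).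

(* If the coefficients of degree at least two are small, the derivative at
   [xi] dominates as soon as the height is large. *)
Lemma height_le_dev : exists2 C : R, 1 <= C &
  forall (P : {poly int}) (G : R), 1 <= G -> (size P <= n.+1)%N ->
    `|ev P| <= 2 -> (forall i, `|(P`_(i.+2))%:~R| <= G) ->
    h P <= C * Num.max `|(P`_1)%:~R| G /\ h P <= C * (`|dev P| + G).
Proof.
pose X := \sum_(i < n) `|xi| ^+ i.+1.
pose Y := \sum_(i < m) `|xi| ^+ i.+1 *+ i.+2.
have X0 : 0 <= X by apply: sumr_ge0 => i _; rewrite exprn_ge0.
have Y0 : 0 <= Y by apply: sumr_ge0 => i _; rewrite mulrn_wge0 // exprn_ge0.
have Cge : 1 <= (3 + X) * (1 + Y) by nra.
exists ((3 + X) * (1 + Y)) => // P G G1 sP eP PG.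
have sP' : (size (map_poly (intr : int -> R) P) <= n.+1)%N.
  by apply: leq_trans sP; apply: size_poly.
set mx := Num.max _ G.
have mxG : G <= mx by rewrite le_max lexx orbT.
have mxP : `|(P`_1)%:~R| <= mx by rewrite le_max lexx.
have P0 : `|(P`_0)%:~R| <= (2 + X) * mx.
  have := horner_coef_wide xi sP'; rewrite big_ord_recl /= expr0 mulr1 coef_map /=.
  set s := \sum_(i < n) _ => E.
  have sX : `|s| <= X * mx.
    apply: (le_trans (ler_norm_sum _ _ _)); rewrite mulr_suml; apply: ler_sum => i _.
    rewrite normrM normrX mulrC ler_wpM2l ?exprn_ge0 // coef_map /=.
    by case: i => -[|i] ? //=; apply: le_trans mxG.
  have -> : (P`_0)%:~R = ev P - s by rewrite E addrK.
  apply: (le_trans (ler_normB _ _)); nra.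
have h1 : h P <= (3 + X) * mx.
  apply: height_ler => [|[|[|i]]]; first by nra.
  - by nra.
  - by nra.
  - by apply: (le_trans (PG i)); nra.
have P1 : `|(P`_1)%:~R| <= `|dev P| + Y * G.
  have sd : (size (map_poly (intr : int -> R) P)^`() <= n)%N.
    by apply: (leq_trans (size_poly _ _)); case: (size _) sP'.
  have := horner_coef_wide xi sd; rewrite big_ord_recl /= expr0 mulr1 coef_deriv coef_map mulr1n /=.
  set s := \sum_(i < m) _ => E.
  have sY : `|s| <= Y * G.
    apply: (le_trans (ler_norm_sum _ _ _)); rewrite mulr_suml; apply: ler_sum => i _.
    rewrite coef_deriv normrM normrX coef_map /= normrMn !mulrnAl lerMn2r /=.
    by rewrite mulrC ler_wpM2l ?exprn_ge0 // PG.
  have -> : (P`_1)%:~R = dev P - s by rewrite E addrK.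
  by apply: (le_trans (ler_normB _ _)); rewrite lerD2l.
split; first by apply: (le_trans h1); rewrite ler_wpM2r //; nra.
apply: (le_trans h1); rewrite -mulrA ler_wpM2l //; first by nra.
rewrite ge_max; apply/andP; split; move: (normr_ge0 (dev P)) => d0; nra.
Qed.

(** Once the height exceeds [K * G], [height_le_dev] bounds it by a multiple of [|P'(xi)|];
    multiplied by the distance [n |P(xi) / P'(xi)|] to a nearby root, the derivative cancels. *)
Lemma davenport_schmidt (w : R) : n%:R <= w -> exists2 K : R, 1 <= K &
  forall G : R, 1 <= G -> exists P : {poly int},
    [/\ (size P <= n.+1)%N, P != 0, `|ev P| <= 2 * G `^ (- w),
        h P <= K * G `^ (w - n%:R + 1)
      & K * G < h P -> exists (a : R[i]) (M : {poly int}),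
        [/\ is_minpolyZ M a, (size M <= n.+1)%N, 0 < dist a,
            dist a * h M <= K * G `^ (- w) & h M <= K * G `^ (w - n%:R + 1)]].
Proof.
move=> nw; have [C C1 HC] := height_le_dev.
have [A A0 HA] := near_algebraic n xi_tr.
(* The summands serve in turn the comparison with the derivative, the height of [M] and the
   distance. *)
pose K := 2 * C + A * C + 4 * A * C * n%:R.
have n0 : 0 <= n%:R :> R by [].
have AC0 : 0 < A * C by rewrite mulr_gt0 //; lra.
have ACn : 0 <= A * C * n%:R by rewrite mulr_ge0 // ltW.
exists K => [|G G1]; first by rewrite /K; lra.
have [P [P0 sP eP Pi P1]] := dirichlet_real xi nw G1.
exists P.
have G0 : 0 < G by lra.
have w0 : 0 <= w by apply: le_trans nw.
have Gw := powR_gt0 (- w) G0; have Gv := powR_gt0 (w - n%:R + 1) G0.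
have eP2 : `|ev P| <= 2.
  by apply: (le_trans eP); rewrite ler_piMr // powRN_le1.
have [h1 h2] := HC P G G1 sP eP2 Pi.
have GG : G <= G `^ (w - n%:R + 1).
  by apply: le1r_powR => //; lra.
have h3 : h P <= C * G `^ (w - n%:R + 1).
  by apply: (le_trans h1); rewrite ler_pM2l ?ge_max ?P1 //; lra.
split=> //.
  by apply: (le_trans h3); rewrite ler_pM2r // /K; lra.
move=> KG; have hd : h P <= 2 * C * `|dev P|.
  have : 2 * C * G <= K * G by rewrite ler_pM2r // /K; lra.
  by lra.
have hP1 := height_ge1 R P0.
have dP0 : dev P != 0 by apply: contraTneq hd => ->; rewrite normr0 mulr0 -ltNge; lra.
have [a [M [Ma sM d0 da hM]]] := HA P sP dP0.
exists a, M; split=> //.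
- apply: (@le_trans _ _ (dist a * (A * (2 * C * `|dev P|)))).
    rewrite ler_pM2l //; apply: (le_trans hM); by rewrite ler_pM2l.
  rewrite [leLHS](_ : _ = 2 * (A * C) * (dist a * `|dev P|)); last by ring.
  apply: (@le_trans _ _ (2 * (A * C) * (n%:R * (2 * G `^ (- w))))).
    rewrite ler_pM2l; last by lra.
    by apply: (le_trans da); rewrite ler_wpM2l.
  rewrite [leLHS](_ : _ = 4 * A * C * n%:R * G `^ (- w)); last by ring.
  by rewrite ler_pM2r // /K; lra.
- apply: (le_trans hM); apply: (@le_trans _ _ (A * (C * G `^ (w - n%:R + 1)))).
    by rewrite ler_pM2l.
  by rewrite mulrA ler_pM2r // /K; lra.
Qed.

Lemma powR_div (H K a : R) : 0 < H -> 0 < K -> (H / K) `^ a = H `^ a / K `^ a.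
Proof.
move=> H0 K0; rewrite powRM ?invr_ge0 ?ltW // -powR_inv1 ?ltW //.
by rewrite powRAC powR_inv1 // powR_ge0.
Qed.

(** For [w = n] the height bound reads [K * G]; the choice [G = H / K] leaves a value of order
    [H^-n], and [v < n] absorbs the constants. *)
Lemma dirichlet_uniform (v : R) : v < n%:R -> uniform_exp n xi v.
Proof.
move=> vn; have [K K1 HK] := davenport_schmidt (lexx n%:R).
have d0 : 0 < n%:R - v by lra.
have [M HM] := powR_large (2 * K `^ n%:R) d0.
exists (Num.max M K); split=> [|H]; first exact: num_real.
rewrite gt_max => /andP[MH KH].
have K0 : 0 < K by lra.
have H0 : 0 < H by lra.
have G1 : 1 <= H / K by rewrite ler_pdivlMr // mul1r ltW.
have [P [sP P0 eP hP _]] := HK _ G1.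
exists P; split=> //.
- rewrite ev_gt0 //=; apply: (le_trans eP).
  rewrite powR_div // !powRN invrK mulrCA mulrC ler_pdivrMr ?powR_gt0 //.
  have := ltW (HM H MH); rewrite powRD; last by rewrite (gt_eqF H0) implybT.
  by rewrite powRN; lra.
- move: hP; rewrite subrr add0r powRr1 ?(ltW (divr_gt0 H0 K0)) // mulrC divfK // gt_eqF //.
Qed.

(** Arbitrarily large [H] admit no solution with exponent [v]. For [G = H / K] the Davenport-Schmidt
    polynomial is small enough at [xi], so its height must exceed [H = K * G], and it yields an
    algebraic number. Comparing the powers of [G] in [c * h M^-W <= K * G^-w] and
    [h M <= K * G^(w-n+1)] gives the claim. *)
Lemma star_of_not_uniform (v w W : R) : ~ uniform_exp n xi v -> v < w ->
  n%:R <= w -> star_lower n xi W -> 0 <= W -> w <= (w - n%:R + 1) * W.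
Proof.
move=> nunif vw nw [c c0 Hc] W0; rewrite leNgt; apply/negP => lt_w.
have [K K1 HK] := davenport_schmidt nw.
have K0 : 0 < K by lra.
have d1 : 0 < w - v by lra.
have d2 : 0 < w - (w - n%:R + 1) * W by lra.
have [M1 HM1] := powR_large (2 * K `^ w) d1.
have [M2 HM2] := powR_large (K `^ (W + 1) / c) d2.
have [H [TH nP]] : exists H, Num.max (Num.max M1 K) (K * M2) < H /\
    ~ exists P : {poly int},
      [/\ (size P <= n.+1)%N, 0 < `|ev P| <= H `^ (- v) & h P <= H].
  apply: contrapT => nH; apply: nunif.
  exists (Num.max (Num.max M1 K) (K * M2)); split=> [|H TH]; first exact: num_real.
  by apply: contrapT => nP; apply: nH; exists H.
move: TH; rewrite !gt_max => /andP[/andP[M1H KH] M2H].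
have H0 : 0 < H by lra.
pose G := H / K.
have G1 : 1 <= G by rewrite ler_pdivlMr // mul1r ltW.
have G0 : 0 < G by lra.
have KG : K * G = H by rewrite mulrC divfK // gt_eqF.
have M2G : M2 < G by rewrite ltr_pdivlMr // mulrC.
have [P [sP P0 eP hP far]] := HK _ G1.
have [|a [M [Ma sM d0 da hM]]] := far.
  rewrite KG ltNge; apply/negP => hPH; apply: nP; exists P; split=> //.
  rewrite ev_gt0 //=; apply: (le_trans eP).
  rewrite powR_div // !powRN invrK mulrCA mulrC ler_pdivrMr ?powR_gt0 //.
  have := ltW (HM1 H M1H); rewrite powRD; last by rewrite (gt_eqF H0) implybT.
  by rewrite powRN; lra.
have M0 := minpolyZ_neq0 Ma.
have hM1 := height_ge1 R M0; have hM0 : 0 < h M by lra.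
have := Hc a M Ma sM; rewrite -(ler_pM2r hM0) => /le_trans /(_ da).
have -> : c * h M `^ (- W - 1) * h M = c * h M `^ (- W).
  rewrite -mulrA -[X in _ * (_ * X)](powRr1 (ltW hM0)) -powRD ?subrK //.
  by rewrite (gt_eqF hM0) implybT.
have h0 : c * (K * G `^ (w - n%:R + 1)) `^ (- W) <= c * h M `^ (- W).
  by rewrite ler_pM2l //; apply: powRN_anti.
move=> /(le_trans h0).
have := HM2 G M2G; rewrite (@powRD _ G); last by rewrite (gt_eqF G0) implybT.
rewrite !powRN powRM ?powR_ge0 ?(ltW K0) // -powRrM powRD; last by rewrite (gt_eqF K0) implybT.
rewrite powRr1 ?(ltW K0) //.
have : 0 < G `^ w by rewrite powR_gt0.
have : 0 < G `^ ((w - n%:R + 1) * W) by rewrite powR_gt0.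
have : 0 < K `^ W by rewrite powR_gt0.
move: (G `^ w) (G `^ _) (K `^ W) => x y z z0 y0 x0.
rewrite ltr_pdivlMr // mulrAC ltr_pdivrMr // => h1 h2.
have := ler_wpM2r (ltW (mulr_gt0 x0 (mulr_gt0 z0 y0))) h2.
rewrite (_ : c / (z * y) * _ = x * c); last by field; rewrite !gt_eqF.
by rewrite (_ : K / x * _ = z * K * y); [lra | field; rewrite !gt_eqF].
Qed.

(** By the lower bound with [w0 < w], a value of at most [2 G^-w] forces a height above [K * G] once
    [G] is large, so every large [G] yields an algebraic number. The strict inequality on [u]
    absorbs the constants. *)
Lemma hat_star_of_poly_lower (w0 w u : R) : poly_lower n xi w0 -> 0 <= w0 ->
  w0 < w -> n%:R <= w -> u * (w - n%:R + 1) < w ->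
  \forall H \near +oo, exists (a : R[i]) (M : {poly int}),
    [/\ is_minpolyZ M a, (size M <= n.+1)%N,
        0 < dist a <= (h M)^-1 * H `^ (- u) & h M <= H].
Proof.
move=> [c c0 Hc] w00 w0w nw uw.
have [K K1 HK] := davenport_schmidt nw.
have K0 : 0 < K by lra.
set e := w - n%:R + 1 in HK uw *.
have e1 : 1 <= e by rewrite /e; lra.
have e0 : 0 < e by lra.
have d1 : 0 < w - w0 by lra.
have d2 : 0 < w / e - u by rewrite subr_gt0 ltr_pdivlMr.
have [M1 HM1] := powR_large (2 * K `^ w0 / c) d1.
have [M2 HM2] := powR_large M1 (divr_gt0 ltr01 e0).
have [M3 HM3] := powR_large (K * K `^ (w / e)) d2.
exists (Num.max (Num.max K M3) (K * M2)); split=> [|H]; first exact: num_real.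
rewrite !gt_max => /andP[/andP[KH M3H] M2H].
have H0 : 0 < H by lra.
have HK1 : 1 <= H / K by rewrite ler_pdivlMr // mul1r ltW.
have HK0 : 0 < H / K by lra.
(* This choice makes the height bound [K * G^e] equal to [H]. *)
pose G := (H / K) `^ (1 / e).
have G1 : 1 <= G.
  have : 1 `^ (1 / e) <= G; last by rewrite powR1.
  apply: ge0_ler_powR => //.
  - by rewrite divr_ge0 // ltW.
  - by rewrite nnegrE.
  - by rewrite nnegrE ltW.
have G0 : 0 < G by lra.
have M1G : M1 < G by apply: HM2; rewrite ltr_pdivlMr // mulrC.
have GE : G `^ e = H / K by rewrite -powRrM mul1r mulVf ?gt_eqF // powRr1 // ltW.
have Gw : G `^ w = (H / K) `^ (w / e) by rewrite -powRrM mul1r [e^-1 * w]mulrC.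
have [P [sP P0 eP hP far]] := HK _ G1.
have hP1 := height_ge1 R P0.
have [|a [M [Ma sM d0 da hM]]] := far.
  rewrite ltNge; apply/negP => hPG.
  have := le_trans (Hc P sP P0) eP.
  have h0 : c * (K * G) `^ (- w0) <= c * h P `^ (- w0).
    by rewrite ler_pM2l //; apply: powRN_anti => //; lra.
  move=> /(le_trans h0).
  have := HM1 G M1G; rewrite powRD; last by rewrite (gt_eqF G0) implybT.
  rewrite !powRN powRM ?(ltW K0) ?(ltW G0) //.
  have : 0 < G `^ w by rewrite powR_gt0.
  have : 0 < G `^ w0 by rewrite powR_gt0.
  have : 0 < K `^ w0 by rewrite powR_gt0.
  move: (G `^ w) (G `^ _) (K `^ w0) => x y z z0 y0 x0.
  rewrite ltr_pdivlMr // mulrAC ltr_pdivrMr // => h1 h2.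
  have := ler_wpM2r (ltW (mulr_gt0 x0 (mulr_gt0 z0 y0))) h2.
  rewrite (_ : c / (z * y) * _ = x * c); last by field; rewrite !gt_eqF.
  by rewrite (_ : 2 / x * _ = 2 * z * y); [lra | field; rewrite !gt_eqF].
have M0 := minpolyZ_neq0 Ma.
have hM1 := height_ge1 R M0; have hM0 : 0 < h M by lra.
exists a, M; split=> //; last first.
  by apply: (le_trans hM); rewrite GE mulrC divfK // gt_eqF.
rewrite d0 /= mulrC ler_pdivlMr //; apply: (le_trans da).
rewrite powRN Gw powR_div // invf_div mulrA ler_pdivrMr ?powR_gt0 //.
have := ltW (HM3 H M3H); rewrite powRD ?(gt_eqF H0) ?implybT //.
by rewrite powRN; lra.
Qed.

Lemma uniform_not_poly_lower (v v' : R) : uniform_exp n xi v' -> v < v' -> 0 <= v ->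
  ~ poly_lower n xi v.
Proof.
move=> [U [_ HU]] vv v0 [c c0 Hc].
have d0 : 0 < v' - v by lra.
have [M HM] := powR_large (1 / c) d0.
pose H := Num.max (Num.max U M) 1 + 1.
have [UH MH H1] : [/\ U < H, M < H & 1 < H].
  have : Num.max (Num.max U M) 1 < H by rewrite ltrDl.
  by rewrite !gt_max => /andP[/andP[-> ->] ->].
have H0 : 0 < H by lra.
have [P [sP /andP[e0 eP] hP]] := HU H UH.
have P0 : P != 0 by apply: contraTneq e0 => ->; rewrite rmorph0 horner0 normr0 ltxx.
have hP1 := height_ge1 R P0.
have := le_trans (Hc P sP P0) eP.
have h0 : c * H `^ (- v) <= c * h P `^ (- v).
  by rewrite ler_pM2l //; apply: powRN_anti => //; lra.
move=> /(le_trans h0).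
have := HM H MH; rewrite powRD ?(gt_eqF H0) ?implybT //.
rewrite !powRN.
have : 0 < H `^ v by rewrite powR_gt0.
have : 0 < H `^ v' by rewrite powR_gt0.
move: (H `^ v) (H `^ v') => x y y0 x0.
rewrite ltr_pdivrMr // mulrAC ltr_pdivlMr // => h1.
rewrite ler_pdivrMr // mulrC ler_pdivlMr //; lra.
Qed.

End Transference.

(** * From suprema to inequalities *)

Lemma normc_sum_le (R : realType) (k : nat) (f : 'I_k -> R[i]) (g : 'I_k -> R) :
  (forall i, ComplexField.Normc.normc (f i) <= g i) ->
  ComplexField.Normc.normc (\sum_i f i) <= \sum_i g i.
Proof.
move=> fg; elim/big_ind2: _ => [|x1 x2 y1 y2 h1 h2|i _]; last exact: fg.
  by rewrite ComplexField.Normc.normc0.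
have := @le_normcD R x2 y2; move=> /le_trans; apply; exact: lerD.
Qed.

Lemma finite_roots (R : realType) (p : {poly R[i]}) : p != 0 ->
  finite_set [set a | root p a].
Proof.
move=> p0; have [s ps] := closed_field_poly_normal p.
apply/finite_seqP; exists s; apply/seteqP; split=> a /=.
  by rewrite ps rootZ ?lead_coef_eq0 // root_prod_XsubC.
by rewrite ps rootZ ?lead_coef_eq0 // root_prod_XsubC.
Qed.

Section Links.
Variables (R : realType) (n : nat) (xi : R).
Hypothesis xi_tr : transcendental xi.

Local Notation ev P := ((map_poly intr P).[xi] : R).
Local Notation h P := ((height P)%:R : R).
Local Notation dist a := (ComplexField.Normc.normc (xi%:C%C - a)).

(** Taylor expansion at [xi]: as [M(a) = 0], [M(xi)] is minus the sum of the terms of positive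
    degree in [a - xi], each at most [S * h M * dist a] because the distance is at most one. *)
Lemma ev_le_dist : exists2 C : R, 0 < C & forall (a : R[i]) (M : {poly int}),
  (size M <= n.+1)%N -> root (map_poly intr M) a -> dist a <= 1 ->
  `|ev M| <= C * h M * dist a.
Proof.
have [S S1 HS] := shift_coef_le n xi.
exists (S * (n%:R + 1)); first by apply: mulr_gt0; [lra | rewrite ltr_wpDl].
move=> a M sM rM d1; set q := map_poly intr M \Po ('X + xi%:P).
have sq : (size q <= n.+1)%N.
  by rewrite size_comp_poly2 ?size_XaddC // (leq_trans _ sM) // size_poly.
pose z := a - xi%:C%C.
have nz : ComplexField.Normc.normc z = dist a by rewrite -[RHS]normcN opprB.
have q0 : (map_poly (real_complex R) q).[z] = 0.
  rewrite /q map_comp_poly /= horner_comp rmorphD /= map_polyX map_polyC /=.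
  rewrite hornerD hornerX hornerC /z subrK -map_poly_comp /=.
  rewrite (eq_map_poly (g := intr)); first exact/eqP.
  by move=> k /=; rewrite rmorph_int.
have sq' : (size (map_poly (real_complex R) q) <= n.+1)%N.
  by rewrite (leq_trans _ sq) // size_poly.
move: q0; rewrite (horner_coef_wide _ sq') big_ord_recl /= expr0 mulr1 coef_map /=.
rewrite shift_coef0; set s := \sum_(i < n) _ => /eqP; rewrite addr_eq0 => /eqP Es.
have : `|ev M| = ComplexField.Normc.normc s.
  by rewrite -(normcN s) -Es /= expr0n addr0 sqrtr_sqr.
move=> ->; apply: (@le_trans _ _ (\sum_(i < n) (S * h M * dist a))).
  apply: normc_sum_le => i; rewrite ComplexField.Normc.normcM coef_map /=.
  apply: ler_pM; rewrite ?normc_ge0 //.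
    by rewrite expr0n addr0 sqrtr_sqr HS.
  rewrite -nz in d1 *; move: (i : nat) => {}i.
  elim: i => [|i IH]; first by rewrite expr1.
  rewrite exprS ComplexField.Normc.normcM.
  by apply: le_trans IH; rewrite ler_piMl ?normc_ge0.
rewrite sumr_const card_ord -[leLHS]mulr_natl.
rewrite [leRHS](_ : _ = (n%:R + 1) * (S * h M * dist a)); last by ring.
by rewrite ler_wpM2r ?lerDl // !mulr_ge0 ?normc_ge0 //; lra.
Qed.

(** An algebraic number close to [xi] makes its minimal polynomial small at [xi]; this is the
    classical [w_n^* <= w_n]. *)
Lemma poly_lower_star_lower (w : R) : 0 <= w -> poly_lower n xi w -> star_lower n xi w.
Proof.
move=> w0 [c c0 Hc]; have [C C0 HC] := ev_le_dist.
exists (Num.min 1 (c / C)); first by rewrite lt_min ltr01 divr_gt0.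
move=> a M Ma sM; have M0 := minpolyZ_neq0 Ma; have hM1 := height_ge1 R M0.
have hM0 : 0 < h M by lra.
have p0 := powR_ge0 (h M) (- w - 1).
have [d1|/ltW d1] := leP (dist a) 1; last first.
  apply: le_trans d1; apply: (@le_trans _ _ (1 * h M `^ (- w - 1))).
    by rewrite ler_wpM2r // ge_min lexx.
  by rewrite mul1r -opprD powRN_le1 // addr_ge0.
apply: (@le_trans _ _ (c / C * h M `^ (- w - 1))).
  by rewrite ler_wpM2r // ge_min lexx orbT.
have [_ _ rM] := Ma.
have := le_trans (Hc M sM M0) (HC a M sM rM d1).
rewrite powRD ?(gt_eqF hM0) ?implybT // powR_inv1 ?(ltW hM0) //.
move: (_ `^ _) => x Hx; rewrite -(ler_pM2l (mulr_gt0 C0 hM0)).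
by rewrite (_ : C * h M * _ = c * x) //; field; rewrite !gt_eqF.
Qed.

(** Above the supremum only finitely many polynomials have nonzero values within [h P^-w], and these
    values have a positive minimum. *)
Lemma w_exp_lt_poly_lower (w : R) : 0 <= w -> (w_exp n xi < w%:E)%E -> poly_lower n xi w.
Proof.
move=> w0 lt_w.
set A := [set P : {poly int} | (size P <= n.+1)%N /\ 0 < `|ev P| <= h P `^ (- w)].
have finA : finite_set A.
  apply: contrapT => infA; move: lt_w; rewrite ltNge => /negP; apply.
  by apply: ereal_sup_ubound; exists w.
have [|c c0 Hc] := @finite_pos_lower_bound R _ A (fun P => `|ev P|) finA.
  by move=> P [_ /andP[]].
exists (Num.min 1 c) => [|P sP P0]; first by rewrite lt_min ltr01.
have h1 := powRN_le1 w0 (height_ge1 R P0); have h0 := powR_ge0 (h P) (- w).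
have [le_e|/ltW lt_e] := leP `|ev P| (h P `^ (- w)).
  apply: (@le_trans _ _ c); last by apply: Hc; split=> //; rewrite ev_gt0.
  have cm : 0 <= Num.min 1 c by rewrite le_min ler01 ltW.
  by rewrite -[leRHS]mulr1 ler_pM // ge_min lexx orbT.
by apply: le_trans lt_e; rewrite ler_piMl // ge_min lexx.
Qed.

Lemma w_star_lt_star_lower (w : R) : 0 <= w -> (w_star n xi < w%:E)%E -> star_lower n xi w.
Proof.
move=> w0 lt_w.
set A := [set a : R[i] | exists P : {poly int},
  [/\ is_minpolyZ P a, (size P <= n.+1)%N & 0 < dist a <= h P `^ (- w - 1)]].
have finA : finite_set A.
  apply: contrapT => infA; move: lt_w; rewrite ltNge => /negP; apply.
  by apply: ereal_sup_ubound; exists w.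
have [|c c0 Hc] := @finite_pos_lower_bound R _ A (fun a => dist a) finA.
  by move=> a [P [_ _ /andP[]]].
exists (Num.min 1 c) => [|a M Ma sM]; first by rewrite lt_min ltr01.
have M0 := minpolyZ_neq0 Ma.
have h1 : h M `^ (- w - 1) <= 1 by rewrite -opprD powRN_le1 ?height_ge1 ?addr_ge0.
have h0 := powR_ge0 (h M) (- w - 1).
have [le_e|/ltW lt_e] := leP (dist a) (h M `^ (- w - 1)).
  have d0 : 0 < dist a by case: Ma => _ _; apply: dist_gt0.
  apply: (@le_trans _ _ c); last by apply: Hc; exists M; split=> //; rewrite d0.
  have cm : 0 <= Num.min 1 c by rewrite le_min ler01 ltW.
  by rewrite -[leRHS]mulr1 ler_pM // ge_min lexx orbT.
by apply: le_trans lt_e; rewrite ler_piMl // ge_min lexx.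
Qed.

Lemma height_bounded_of_lower (c w w' : R) : 0 < c -> w < w' ->
  exists N : nat, forall P : {poly int}, P != 0 ->
    c * h P `^ (- w) <= h P `^ (- w') -> (height P <= N)%N.
Proof.
move=> c0 ww; have d0 : 0 < w' - w by lra.
have [M HM] := powR_large (1 / c) d0.
exists (Num.bound `|M|) => P P0; have hP0 : 0 < h P by rewrite ltr0n height_gt0.
apply: contraTT; rewrite -ltnNge -(ltr_nat R) => ltN; rewrite -ltNge.
have MP : M < h P.
  by apply: lt_trans ltN; apply: le_lt_trans (ler_norm M) _; apply: archi_boundP.
have := HM _ MP; rewrite powRD ?(gt_eqF hP0) ?implybT // !powRN.
have : 0 < h P `^ w by rewrite powR_gt0.
have : 0 < h P `^ w' by rewrite powR_gt0.
move: (h P `^ w) (h P `^ w') => x y y0 x0.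
rewrite ltr_pdivrMr // mulrAC ltr_pdivlMr // mul1r => h1.
by rewrite ltr_pdivlMr // mulrC ltr_pdivrMr //; lra.
Qed.

Lemma poly_lower_ge_w_exp (w : R) : poly_lower n xi w -> (w_exp n xi <= w%:E)%E.
Proof.
move=> [c c0 Hc]; apply: ge_ereal_sup => _ [w' infA <-]; rewrite lee_fin leNgt.
apply/negP => lt_w; have [N HN] := height_bounded_of_lower c0 lt_w.
apply: infA; apply: sub_finite_set (finite_bounded_height n N) => P [sP /andP[e0 eP]].
have P0 : P != 0 by apply: contraTneq e0 => ->; rewrite rmorph0 horner0 normr0 ltxx.
by split=> //; apply: HN => //; apply: le_trans eP; apply: Hc.
Qed.

Lemma star_lower_ge_w_star (w : R) : star_lower n xi w -> (w_star n xi <= w%:E)%E.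
Proof.
move=> [c c0 Hc]; apply: ge_ereal_sup => _ [w' infA <-]; rewrite lee_fin leNgt.
apply/negP => lt_w.
have [|N HN] := @height_bounded_of_lower c (w + 1) (w' + 1) c0; first by lra.
apply: infA.
(* Bounded height leaves finitely many minimal polynomials, each with finitely many roots. *)
apply: (@sub_finite_set _ _ (\bigcup_(P in [set P : {poly int} |
    ((size P <= n.+1)%N /\ (height P <= N)%N) /\ P != 0]) [set a | root (map_poly intr P) a])).
  move=> a [P [Pa sP /andP[d0 da]]]; have P0 := minpolyZ_neq0 Pa.
  exists P => /=; last by case: Pa.
  split=> //; split=> //; apply: HN => //; rewrite !opprD.
  by apply: le_trans da; apply: Hc.
apply: bigcup_finite.
  by apply: sub_finite_set (finite_bounded_height n N) => P [].
move=> P [_ P0]; apply: finite_roots.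
by rewrite map_poly_eq0_id0 ?intr_eq0 ?lead_coef_eq0.
Qed.

Lemma lt_w_hat_uniform (v : R) : (v%:E < w_hat n xi)%E ->
  exists2 v', v < v' & uniform_exp n xi v'.
Proof.
by move=> /ereal_sup_gt[_ [v' Hv' <-]]; rewrite lte_fin => lt_v; exists v'.
Qed.

Lemma uniform_exp_le (v v' : R) : v <= v' -> uniform_exp n xi v' -> uniform_exp n xi v.
Proof.
move=> vv [M [_ HM]]; exists (Num.max M 1); split=> [|H]; first exact: num_real.
rewrite gt_max => /andP[MH H1]; have [P [sP /andP[e0 eP] hP]] := HM H MH.
exists P; split=> //; rewrite e0 /=; apply: (le_trans eP).
by apply: ler_powR; [exact: ltW | rewrite lerN2].
Qed.

Lemma uniform_exp_le_w_hat (v : R) : uniform_exp n xi v -> (v%:E <= w_hat n xi)%E.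
Proof. by move=> Hv; apply: ereal_sup_ubound; exists v. Qed.

End Links.

(** * Relations between the exponents *)

(** Serves to pass to the limit in estimates that hold for exponents perturbed by [e], with an error
    linear in [e]. *)
Lemma le_of_forall_small (R : realType) (a b c : R) :
  (forall e, 0 < e < 1 -> a <= b + e * c) -> a <= b.
Proof.
move=> H; rewrite leNgt; apply/negP => ba.
pose e := (a - b) / (2 * (`|c| + (a - b) + 1)).
have c0 := normr_ge0 c; have cc := ler_norm c.
have D0 : 0 < 2 * (`|c| + (a - b) + 1) by lra.
have e0 : 0 < e by rewrite divr_gt0 //; lra.
have e1 : e < 1 by rewrite ltr_pdivrMr //; lra.
have := H e; rewrite e0 e1 => /(_ isT).
have : e * (2 * (`|c| + (a - b) + 1)) = a - b by rewrite divfK // gt_eqF.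
have : e * c <= e * `|c| by rewrite ler_pM2l.
by nra.
Qed.

Section Values.
Variables (R : realType) (m : nat) (xi : R).
Hypothesis xi_tr : transcendental xi.
Local Notation n := m.+1.

Lemma w_hat_ge : (n%:R%:E <= w_hat n xi)%E.
Proof.
rewrite leNgt; apply/negP => lt_n.
have [v [lt_v vn]] : exists v : R, (w_hat n xi < v%:E)%E /\ v < n%:R.
  move: lt_n; case: (w_hat n xi) => [r| |] //; rewrite ?lte_fin => rn.
    exists ((r + n%:R) / 2); rewrite lte_fin; split; lra.
  by exists (n%:R - 1); split; [rewrite ltNyr | lra].
move: lt_v; rewrite ltNge => /negP; apply; apply: uniform_exp_le_w_hat.
exact: dirichlet_uniform.
Qed.

Lemma w_hat_le_w_exp : (w_hat n xi <= w_exp n xi)%E.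
Proof.
rewrite leNgt; apply/negP => lt_w.
have [v v0 [wv vh]] : exists2 v : R, 0 <= v & (w_exp n xi < v%:E /\ v%:E < w_hat n xi)%E.
  have nh := w_hat_ge; have n0 : 0 <= n%:R :> R by [].
  move: lt_w nh; case: (w_exp n xi) => [r| |]; case: (w_hat n xi) => [r'| |] //;
    rewrite ?lte_fin ?lee_fin => rr nh.
  - exists (Num.max 0 ((r + r') / 2)); first by rewrite le_max lexx.
    have : 1 <= n%:R :> R by rewrite ler1n.
    by rewrite !lte_fin lt_max gt_max => ?; split; [apply/orP; right | apply/andP; split]; lra.
  - exists (Num.max 0 (r + 1)); first by rewrite le_max lexx.
    by rewrite lte_fin ltry lt_max; split=> //; apply/orP; right; lra.
  - have n1 : 1 <= n%:R :> R by rewrite ler1n.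
    by exists 0 => //; rewrite ltNyr lte_fin; split=> //; lra.
  - by exists 0 => //; rewrite ltNyr ltry.
have [v' vv' Hv'] := lt_w_hat_uniform vh.
exact: uniform_not_poly_lower Hv' vv' v0 (w_exp_lt_poly_lower xi_tr v0 wv).
Qed.

Lemma w_star_le_w_exp : (w_star n xi <= w_exp n xi)%E.
Proof.
have n0 : 0 <= n%:R :> R by [].
have := le_trans w_hat_ge w_hat_le_w_exp.
case Ew: (w_exp n xi) => [r| |] //; last by move=> _; rewrite leey.
rewrite lee_fin => nr; apply/lee_addgt0Pr => e e0; rewrite -EFinD.
apply: star_lower_ge_w_star => //; apply: poly_lower_star_lower => //; first by lra.
by apply: w_exp_lt_poly_lower => //; [lra | rewrite Ew lte_fin; lra].
Qed.

(** The alternative [w = v] gives [3 v <= 2 W + 2 n - 1] without reference to [w_exp], which may be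
    infinite. *)
Lemma w_hat_exp_star (w v W : R) : (v%:E < w_hat n xi)%E ->
  (w%:E < w_exp n xi)%E \/ w = v -> (w_star n xi < W%:E)%E ->
  1 <= W -> n%:R - 1 < v -> v <= w -> w + 2 * v <= 2 * W + 2 * n%:R - 1.
Proof.
move=> vh wE sW W1 nv vw; have [v' vv' Hv'] := lt_w_hat_uniform vh.
have n1 : 1 <= n%:R :> R by rewrite ler1n.
apply: (@exponent_inequality _ n xi xi_tr) => //.
- case: wE => [lt_w low|->]; last by apply: uniform_not_poly_lower Hv' vv' _; lra.
  by move: lt_w; rewrite ltNge => /negP; apply; apply: poly_lower_ge_w_exp.
- by apply: uniform_exp_le Hv'; apply: ltW.
- by apply: w_star_lt_star_lower => //; lra.
Qed.

Lemma w_hat_star_relation (w W : R) : (w_hat n xi < w%:E)%E ->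
  (w_star n xi < W%:E)%E -> 0 <= W -> w <= (w - n%:R + 1) * W.
Proof.
move=> hw sW W0.
have [v [hv vw]] : exists v : R, (w_hat n xi < v%:E)%E /\ v < w.
  have := w_hat_ge; move: hw; case: (w_hat n xi) => [r| |] //; rewrite lte_fin => ? _.
  by exists ((r + w) / 2); rewrite lte_fin; split; lra.
apply: (@star_of_not_uniform _ _ xi xi_tr v) => //.
- by move=> /uniform_exp_le_w_hat; rewrite leNgt hv.
- by have := le_lt_trans w_hat_ge hw; rewrite lte_fin => /ltW.
- exact: w_star_lt_star_lower.
Qed.

Lemma w_star_hat_bounds : w_star n xi != +oo%E -> exists s r : R,
  [/\ w_star n xi = s%:E /\ w_hat n xi = r%:E, n%:R <= r, 1 <= s,
      r <= (r - n%:R + 1) * s & 3 * r <= 2 * s + 2 * n%:R - 1].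
Proof.
move=> sfin; have n1 : 1 <= n%:R :> R by rewrite ler1n.
(* Taking [w = v] just below [w_hat] gives the first bound and, with it, the finiteness of
   [w_hat]. *)
have claimA (W : R) : (w_star n xi < W%:E)%E -> 1 <= W ->
    (w_hat n xi <= ((2 * W + 2 * n%:R - 1) / 3)%:E)%E.
  move=> sW W1; rewrite leNgt; apply/negP => lt_h.
  set b := (2 * W + 2 * n%:R - 1) / 3 in lt_h.
  have [v [bv nv vh]] : exists v : R, [/\ (b < v), (n%:R - 1 < v) & (v%:E < w_hat n xi)%E].
    move: lt_h w_hat_ge; case: (w_hat n xi) => [r| |] //; rewrite ?lte_fin ?lee_fin => br nr.
      by exists (Num.max ((b + r) / 2) (n%:R - 1 / 2)); rewrite lte_fin !lt_max gt_max;
        split; [apply/orP; left|apply/orP; right|apply/andP; split]; lra.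
    by exists (Num.max (b + 1) n%:R); rewrite ltry !lt_max; split=> //; apply/orP; [left|right]; lra.
  have := w_hat_exp_star vh (or_intror erefl) sW W1 nv (lexx v).
  by rewrite /b in bv; lra.
have [W0 sW0 W01] : exists2 W : R, (w_star n xi < W%:E)%E & 1 <= W.
  move: sfin; case: (w_star n xi) => [s| |] // _.
    by exists (Num.max (s + 1) 1); rewrite ?lte_fin ?lt_max ?le_max ?lexx ?orbT // ltrDl ltr01.
  by exists 1; rewrite ?ltNyr.
have := claimA _ sW0 W01; have := w_hat_ge.
case Er: (w_hat n xi) => [r| |] //; rewrite lee_fin => nr _.
have relW (W w : R) : (w_star n xi < W%:E)%E -> 0 <= W -> r < w -> w <= (w - n%:R + 1) * W.
  by move=> sW W00 rw; apply: w_hat_star_relation => //; rewrite Er lte_fin.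
(* At [w = r + 1] the relation reads [r + 1 <= (r - n + 2) W], where [n >= 1]. *)
have W1 (W : R) : (w_star n xi < W%:E)%E -> 0 <= W -> 1 <= W.
  move=> sW W00; have := relW W (r + 1) sW W00; rewrite ltrDl ltr01 => /(_ isT).
  by nra.
have [s Es s1] : exists2 s : R, w_star n xi = s%:E & 1 <= s.
  case Es: (w_star n xi) sfin => [s| |] // _; last first.
    by have := W1 (1 / 2); rewrite Es ltNyr => /(_ isT); lra.
  exists s => //; rewrite leNgt; apply/negP => s1.
  have sW : (w_star n xi < (Num.max 0 ((s + 1) / 2))%:E)%E.
    by rewrite Es lte_fin lt_max; apply/orP; right; lra.
  have := W1 _ sW; rewrite !le_max lexx => /(_ isT) /orP[]; lra.
exists s, r; split=> //.
- apply: (@le_of_forall_small _ _ _ (s + (r - n%:R + 1) + 1)) => e /andP[e0 e1].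
  have := relW (s + e) (r + e); rewrite Es lte_fin !ltrDl e0 => /(_ isT _ isT).
  by move=> H; have := H ltac:(lra); nra.
- apply: (@le_of_forall_small _ _ _ 2) => e /andP[e0 e1].
  have := claimA (s + e); rewrite Es Er lte_fin lee_fin ltrDl e0 => /(_ isT).
  by move=> H; have := H ltac:(lra); lra.
Qed.

Lemma w_exp_hat_star_bound (s r w : R) : w_star n xi = s%:E ->
  w_hat n xi = r%:E -> w_exp n xi = w%:E -> 1 <= s -> n%:R <= r -> r <= w ->
  w + 2 * r <= 2 * s + 2 * n%:R - 1.
Proof.
move=> Es Er Ew s1 nr rw; apply: (@le_of_forall_small _ _ _ 5) => e /andP[e0 e1].
have := @w_hat_exp_star (w - e) (r - e) (s + e).
rewrite Es Er Ew !lte_fin => H; clear Es Er Ew.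
suff : w - e + 2 * (r - e) <= 2 * (s + e) + 2 * n%:R - 1 by lra.
by apply: H; try lra; left; lra.
Qed.

Lemma w_hat_star_ge (w u : R) : w_exp n xi = w%:E -> n%:R <= w ->
  u * (w - n%:R + 1) < w -> (u%:E <= w_hat_star n xi)%E.
Proof.
move=> Ew nw uw; have n1 : 1 <= n%:R :> R by rewrite ler1n.
(* This [e] gives [u (w + e - n + 1) <= w - e], so [u] stays admissible for [w + e], while
   [poly_lower] holds at [w + e / 2]. *)
pose e := (w - u * (w - n%:R + 1)) / (1 + `|u|).
have u0 := normr_ge0 u; have uu := ler_norm u.
have e0 : 0 < e by rewrite divr_gt0 //; lra.
have eE : e * (1 + `|u|) = w - u * (w - n%:R + 1) by rewrite divfK // gt_eqF //; lra.
apply: ereal_sup_ubound; exists u => //.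
have low : poly_lower n xi (w + e / 2).
  by apply: w_exp_lt_poly_lower; rewrite ?Ew ?lte_fin //; clear Ew; lra.
clear Ew; apply: (hat_star_of_poly_lower xi_tr low (w := w + e)); try lra.
have : e * u <= e * `|u| by rewrite ler_pM2l.
by lra.
Qed.

End Values.

(** The relation [(n - 1) s <= r (s - 1)] eliminates [r] and leaves [(w - n + 1) (s - 1) <= D] for
    the denominator [D]. The numerator is [D + (n - 1) (s - 1)], so after cancellation the claim is
    this inequality times [n - 1]. *)
Lemma star_quotient_bound (R : realType) (n s r w : R) : 1 < n -> n <= r -> r <= w ->
  1 <= s -> r <= (r - n + 1) * s -> w + 2 * r <= 2 * s + 2 * n - 1 ->
  0 < 2 * s ^+ 2 - n * s - n /\
  (2 * s ^+ 2 - s - 2 * n + 1) * (w - n + 1) <= w * (2 * s ^+ 2 - n * s - n).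
Proof.
move=> n1 nr rw s1 rs wrs.
have s1' : 1 < s by rewrite lt_neqAle s1 andbT; apply/eqP => E; rewrite -E in rs; lra.
have h1 : (n - 1) * s <= r * (s - 1) by lra.
have h2 : (w + 2 * r) * (s - 1) <= (2 * s + 2 * n - 1) * (s - 1) by rewrite ler_wpM2r //; lra.
have D1 : (w - n + 1) * (s - 1) <= 2 * s ^+ 2 - n * s - n by rewrite expr2; lra.
have D2 : 1 * (s - 1) <= (w - n + 1) * (s - 1) by rewrite ler_wpM2r //; lra.
split; first by lra.
have : (n - 1) * ((w - n + 1) * (s - 1)) <= (n - 1) * (2 * s ^+ 2 - n * s - n).
  by rewrite ler_wpM2l //; lra.
by rewrite expr2; lra.
Qed.

Local Open Scope ereal_scope.

Theorem theorem2p7 (R : realType) (n : nat) (xi : R)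
    (n_gt0 : (0 < n)%N) (xi_tr : transcendental xi) :
  w_hat n xi <= (2%:E * (w_star n xi + n%:R%:E) - 1%:E) / 3%:E /\
  (w_exp n xi <= (2 * n%:R - 1)%:E ->
   (2%:E * w_star n xi ^+ 2 - w_star n xi - 2%:E * n%:R%:E + 1%:E) /
   (2%:E * w_star n xi ^+ 2 - n%:R%:E * w_star n xi - n%:R%:E)
   <= w_hat_star n xi).
Proof.
have t0 : (3 != 0 :> R)%R by rewrite pnatr_eq0.
case: n n_gt0 => // m _; split.
  have [sy|sfin] := eqVneq (w_star m.+1 xi) +oo.
    rewrite sy addye // gt0_muley ?lte_fin // addye // inver (negbTE t0).
    by rewrite gt0_mulye ?leey // lte_fin invr_gt0.
  have [s [r [[-> ->] _ _ _ h]]] := w_star_hat_bounds xi_tr sfin.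
  rewrite inver (negbTE t0) -EFinD -EFinM lee_fin ler_pdivlMr //.
  by lra.
move=> hw; have sw := w_star_le_w_exp m xi_tr.
(* The bound on [w_exp] makes [w_star] finite. *)
have sfin : w_star m.+1 xi != +oo.
  by have := le_lt_trans (le_trans sw hw) (ltry _); rewrite lt_neqAle => /andP[].
have [s [r [[Es Er] nr s1 rs _]]] := w_star_hat_bounds xi_tr sfin.
have := w_hat_le_w_exp m xi_tr; rewrite Er.
case Ew: (w_exp m.+1 xi) hw => [w| |] // hw; rewrite lee_fin => rw.
have bnd := w_exp_hat_star_bound xi_tr Es Er Ew s1 nr rw.
have nw := le_trans nr rw.
(* Any [q] up to [w / (w - n + 1)] is approached from below by values covered by [w_hat_star_ge]. *)
have key (q : R) : (q * (w - m.+1%:R + 1) <= w)%R -> q%:E <= w_hat_star m.+1 xi.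
  move=> qw; apply/lee_subgt0Pr => e e0; rewrite -EFinB.
  apply: (w_hat_star_ge xi_tr Ew nw); clear -qw e0 nw.
  have : (0 < e * (w - m.+1%:R + 1))%R by rewrite mulr_gt0 //; lra.
  by lra.
rewrite Es -EFin_expe -!EFinM -?EFinB -?EFinD inver.
clear sw Es Er Ew hw xi_tr t0 sfin.
case: m nr rs bnd nw key => [|m] nr rs bnd nw key.
  (* For [n = 1] numerator and denominator coincide: the quotient is [1], or [0] when both vanish,
     since a zero numerator annihilates the inverse. *)
  case: ifP => [/eqP D0|/negbT D0].
    rewrite (_ : (_ + 1)%R = 0%R) ?mul0e; last by rewrite -D0; ring.
    by apply: key; rewrite mul0r; lra.
  rewrite -EFinM (_ : (_ * _)%R = 1%R); first by apply: key; lra.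
  rewrite (_ : (_ + 1)%R = (2 * s ^+ 2 - 1%:R * s - 1%:R)%R) ?divff //.
  by ring.
have n1 : (1 < m.+2%:R :> R)%R by rewrite ltr1n.
have [D0 H] := star_quotient_bound n1 nr rw s1 rs bnd.
rewrite (gt_eqF D0) -EFinM; apply: key.
by rewrite mulrAC ler_pdivrMr.
Qed.
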